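(* Let $N\ge 2$, $A\in M_N(\{0,1\})$, and let $({\cal H},\pi)$ be a permutative representation of ${\cal O}_A$ with phases. Then the following holds. (i) $({\cal H},\pi)$ is decomposed into the direct sum of cyclic permutative representations with phases uniquely up to unitary equivalence. (ii) If $({\cal H},\pi)$ is cyclic, then $({\cal H},\pi)$ is either $P(J;z)$ for some finite word $J=(j_1,\ldots,j_p)$ and some $z\in U(1)$, or $P(J)$ for some infinite word $J=(j_n)_{n\in{\bf N}}$. Moreover, for all $p,p'\ge 1$, $(j_n)_{n=1}^{p}\in\{1,\ldots,N\}^p_{A,c}$, $(j'_n)_{n=1}^{p'}\in\{1,\ldots,N\}^{p'}_{A,c}$, $c,c'\in U(1)$ and $(k_n)_{n\in{\bf N}},(k'_n)_{n\in{\bf N}}\in\{1,\ldots,N\}^\infty_A$: (iii) $P((j_n)_{n=1}^p;c)$ is irreducible if and only if there is no $\sigma\in{\bf Z}_p\setminus\{id\}$ such that $(j_{\sigma(1)},\ldots,j_{\sigma(p)})=(j_1,\ldots,j_p)$. Respectively, $P((k_n)_{n\in{\bf N}})$ is irreducible if and only if there is no $(q,n_0)\in{\bf N}\times{\bf N}$ such that $k_{n+q}=k_n$ for each $n\ge n_0$. (iv) $P((j_n)_{n=1}^p;c)\not\sim P((k_n)_{n\in{\bf N}})$. (v) $P((j_n)_{n=1}^p;c)\sim P((j'_n)_{n=1}^{p'};c')$ if and only if $p=p'$, $c=c'$ and there is $\sigma\in{\bf Z}_p$ such that $j'_{\sigma(n)}=j_n$ for each $n=1,\ldots,p$. (vi)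 $P((k_n)_{n\in{\bf N}})\sim P((k'_n)_{n\in{\bf N}})$ if and only if there is $(q,n_0)\in{\bf Z}\times{\bf N}$ such that $k_{n+q}=k'_n$ for each $n\ge n_0$.
   Context: ${\bf N}=\{1,2,\ldots\}$, $U(1)=\{z\in{\bf C}:|z|=1\}$. $M_N(\{0,1\})$ is the set of $N\times N$ matrices with entries in $\{0,1\}$ having no row or column identically equal to zero. For $A=(a_{ij})\in M_N(\{0,1\})$, the Cuntz-Krieger algebra ${\cal O}_A$ is the $C^*$-algebra universally generated by partial isometries $s_1,\ldots,s_N$ satisfying $s_i^*s_i=\sum_{j=1}^N a_{ij}s_js_j^*$ for $i=1,\ldots,N$ and $\sum_{i=1}^N s_is_i^*=I$. A representation is a unital $*$-representation on a complex Hilbert space; $\sim$ denotes unitary equivalence. $\{1,\ldots,N\}^k_{A,c}$ ($k\ge1$) is the set of $(j_1,\ldots,j_k)\in\{1,\ldots,N\}^k$ with $a_{j_{i-1}j_i}=1$ for $i=2,\ldots,k$ and $a_{j_kj_1}=1$. $\{1,\ldots,N\}^\infty_A$ is the set of sequences $(j_n)_{n\in{\bf N}}$ in $\{1,\ldots,N\}$ with $a_{j_{n-1}j_n}=1$ for all $n\ge2$. ${\bf Z}_p$ is the group of cyclic permutations of $\{1,\ldots,p\}$. A representation $({\cal H},\pi)$ of ${\cal O}_A$ is a permutative representation with phases if there are a complete orthonormal basis $\{e_n\}_{n\in\Lambda}$ of ${\cal H}$, subsets $\Lambda_1,\ldots,\Lambda_N$ of $\Lambda$ and $(z_{i,n},m_{i,n})\in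 U(1)\times\Lambda$ (for $i=1,\ldots,N$, $n\in\Lambda_i$) such that $\pi(s_i)e_n=z_{i,n}e_{m_{i,n}}$ if $n\in\Lambda_i$ and $\pi(s_i)e_n=0$ otherwise. For $J=(j_l)_{l=1}^p\in\{1,\ldots,N\}^p$ and $z\in U(1)$, $({\cal H},\pi)$ is $P(J;z)$ if there is a cyclic unit vector $\Omega\in{\cal H}$ such that $\pi(s_{j_1}\cdots s_{j_p})\Omega=z\Omega$ and $\{\pi(s_{j_l}\cdots s_{j_p})\Omega\}_{l=1}^p$ is an orthonormal family. For $J=(j_n)_{n\in{\bf N}}\in\{1,\ldots,N\}^\infty$, $({\cal H},\pi)$ is $P(J)$ if there is a cyclic unit vector $\Omega\in{\cal H}$ such that $\{\pi(s_{j_n}^*\cdots s_{j_1}^* )\Omega\}_{n\in{\bf N}}$ is an orthonormal family. For $J\in\{1,\ldots,N\}^p_{A,c}$ (resp. $J\in\{1,\ldots,N\}^\infty_A$) the symbol $P(J;z)$ (resp. $P(J)$) also denotes the unitary equivalence class of representations with the corresponding property.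
   Formalization: In (i), the decomposition and its uniqueness are along a given permutative basis (P(11;1) ~ P(1;1)+P(1;-1) breaks literal uniqueness); in (ii), ''cyclic'' means some vector of the permutative basis is cyclic (P(1;1)+P(2;1) breaks the literal claim). *)

(* Defs.v *)
From HB Require Import structures.
From mathcomp Require Import all_boot all_order all_algebra all_fingroup.
From mathcomp Require Import sesquilinear complex.
From mathcomp Require Import all_classical all_reals all_analysis.

Set Implicit Arguments.
Unset Strict Implicit.
Unset Printing Implicit Defensive.

Import Order.TTheory GRing.Theory Num.Theory.
Import numFieldNormedType.Exports.

Local Open Scope classical_set_scope.
Local Open Scope ring_scope.

(* Complex Hilbert spaces; the inner product is linear in its first argument. *)
HB.mixin Record CompleteNormedModule_isHilbert (R : realType) H
    & CompleteNormedModule R[i] H := {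
  dot : {dot H for Num.conj};
  dot_norm : forall u : H, dot u u = `|u| ^+ 2
}.

#[short(type="hilbertType")]
HB.structure Definition Hilbert (R : realType) :=
  {H of CompleteNormedModule R[i] H & CompleteNormedModule_isHilbert R H}.

(* Unital C*-algebras, over the algebraic hierarchy (it has no join with the
   normed modules).  As for MathComp norms, the norm takes its values in the
   nonnegative real elements of R[i]. *)
HB.mixin Record Algebra_isCstar (R : realType) B & GRing.Algebra R[i] B := {
  cnorm : B -> R[i];
  cnormD : forall x y : B, cnorm (x + y) <= cnorm x + cnorm y;
  cnormZ : forall (a : R[i]) (x : B), cnorm (a *: x) = `|a| * cnorm x;
  cnorm_eq0 : forall x : B, cnorm x = 0 -> x = 0;
  cnormM : forall x y : B, cnorm (x * y) <= cnorm x * cnorm y;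
  cnorm_complete : forall u : nat -> B,
    (forall e : R[i], 0 < e ->
       \forall m & n \near \oo, cnorm (u m - u n) < e) ->
    exists l : B, forall e : R[i], 0 < e ->
      \forall n \near \oo, cnorm (u n - l) < e;
  star : B -> B;
  starD : forall x y : B, star (x + y) = star x + star y;
  starZ : forall (a : R[i]) (x : B), star (a *: x) = Num.conj a *: star x;
  starM : forall x y : B, star (x * y) = star y * star x;
  starK : forall x : B, star (star x) = x;
  cnorm_star : forall x : B, cnorm (star x * x) = cnorm x ^+ 2
}.

#[short(type="cstarAlgType")]
HB.structure Definition CstarAlgebra (R : realType) :=
  {B of GRing.Algebra R[i] B & Algebra_isCstar R B}.

Section CuntzKrieger.
Context {R : realType} {N : nat}.
Implicit Type A : 'M[bool]_N.

(* M_N({0,1}): no zero row and no zero column. *)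
Definition nondegenerate_mx A : Prop :=
  (forall i, exists j, A i j) /\ (forall j, exists i, A i j).

Definition cuntz_krieger_family A (B : cstarAlgType R) (t : 'I_N -> B) : Prop :=
  [/\ forall i, t i * star (t i) * t i = t i,
      forall i, star (t i) * t i = \sum_j (A i j)%:R *: (t j * star (t j))
    & \sum_i t i * star (t i) = 1].

(* (O, s) is O_A with its canonical generators: the s i generate O as a unital
   C*-algebra, and any Cuntz-Krieger family is the image of s under a unital
   *-homomorphism. *)
Definition is_cuntz_krieger_algebra A (O : cstarAlgType R) (s : 'I_N -> O)
    : Prop :=
  [/\ cuntz_krieger_family A s,
      forall S : set O,
        subalg_closed (mem S) -> (forall x, S x -> S (star x)) ->
        (forall (u : nat -> O) (l : O), (forall n, S (u n)) ->
           (forall e : R[i], 0 < e ->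
              \forall n \near \oo, cnorm (u n - l) < e) -> S l) ->
        (forall i, S (s i)) -> S = setT
    & forall (B : cstarAlgType R) (t : 'I_N -> B), cuntz_krieger_family A t ->
        exists f : {lrmorphism O -> B},
          (forall x, f (star x) = star (f x)) /\ (forall i, f (s i) = t i)].

End CuntzKrieger.

(* Unital *-homomorphisms from O to the bounded operators on H. *)
Record representation (R : realType) (O : cstarAlgType R) (H : hilbertType R) :=
  Representation {
    rep_op :> O -> {linear H -> H};
    rep_bounded : forall x, continuous (rep_op x);
    rep_linear : forall (a : R[i]) x y u,
      rep_op (a *: x + y) u = a *: rep_op x u + rep_op y u;
    rep_one : forall u, rep_op 1 u = u;
    rep_mul : forall x y u, rep_op (x * y) u = rep_op x (rep_op y u);
    rep_star : forall x u v, dot (rep_op x u) v = dot u (rep_op (star x) v)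
  }.

Section HilbertSpaces.
Context {R : realType} {H : hilbertType R}.

Definition orthonormal_family (I : Type) (e : I -> H) : Prop :=
  (forall i, dot (e i) (e i) = 1) /\
  (forall i j, i <> j -> dot (e i) (e j) = 0).

Definition closed_subspace (M : set H) : Prop :=
  submod_closed (mem M) /\ closed M.

Definition closed_span (S : set H) : set H := smallest closed_subspace S.

Definition orthonormal_basis (I : Type) (e : I -> H) : Prop :=
  orthonormal_family e /\ closed_span (range e) = setT.

End HilbertSpaces.

Section Representations.
Context {R : realType} {O : cstarAlgType R}.
Implicit Types H : hilbertType R.

Definition cyclic_vector H (pi : representation O H) (Omega : H) : Prop :=
  closure (range (fun x : O => pi x Omega)) = setT.

Definition irreducible H (pi : representation O H) : Prop :=
  (exists u : H, u <> 0) /\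
  forall M : set H, closed_subspace M ->
    (forall x u, M u -> M (pi x u)) -> M = [set 0] \/ M = setT.

Definition unitarily_equivalent H (pi : representation O H)
    H' (pi' : representation O H') : Prop :=
  exists U : {linear H -> H'},
    [/\ forall u v, dot (U u) (U v) = dot u v,
        forall v, exists u, U u = v
      & forall x u, U (pi x u) = pi' x (U u)].

(* (H, pi) is the direct sum of the (Hk k, pik k), through the isometric
   embeddings V k. *)
Definition is_direct_sum H (pi : representation O H) (K : Type)
    (Hk : K -> hilbertType R) (pik : forall k, representation O (Hk k))
    (V : forall k, {linear Hk k -> H}) : Prop :=
  [/\ forall k u v, dot (V k u) (V k v) = dot u v,
      forall k l u v, k <> l -> dot (V k u) (V l v) = 0,
      closed_span (\bigcup_k range (V k)) = setT
    & forall k x u, V k (pik k x u) = pi x (V k u)].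

Context {N : nat} (s : 'I_N -> O).

(* z i n and m i n are meaningful only for n in the domain L i. *)
Definition permutative_basis H (pi : representation O H)
    (L : Type) (e : L -> H) : Prop :=
  orthonormal_basis e /\
  exists (D : 'I_N -> set L) (z : 'I_N -> L -> R[i]) (m : 'I_N -> L -> L),
    forall i n,
      (D i n -> `|z i n| = 1 /\ pi (s i) (e n) = z i n *: e (m i n)) /\
      (~ D i n -> pi (s i) (e n) = 0).

(* For a permutative representation, cyclicity means that some vector of the
   basis is cyclic.  The mere existence of a cyclic vector would be too weak:
   for s_1 s_1^* + s_2 s_2^* = 1 and s_i^* s_i = 1, the inequivalent irreducible
   representations P(1;1) and P(2;1) have a direct sum with a cyclic vector,
   which is neither of the form P(J;z) nor P(J). *)
Definition cyclic_permutative_basis H (pi : representation O H)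
    (L : Type) (e : L -> H) : Prop :=
  permutative_basis pi e /\ exists n, cyclic_vector pi (e n).

(* A decomposition of (H, pi) into cyclic permutative representations, along
   the basis e: the basis of each summand consists of vectors of e.  Without
   this compatibility a decomposition is not unique, even up to equivalence:
   P(11;1) is cyclic and also equivalent to the direct sum of P(1;1) and
   P(1;-1). *)
Definition cyclic_decomposition H (pi : representation O H)
    (L : Type) (e : L -> H) (K : Type)
    (Hk : K -> hilbertType R) (pik : forall k, representation O (Hk k)) : Prop :=
  exists V : forall k, {linear Hk k -> H},
    is_direct_sum pi pik V /\
    forall k, exists (Lk : Type) (ek : Lk -> Hk k),
      cyclic_permutative_basis (pik k) ek /\
      forall n, range e (V k (ek n)).

(* P(J;z); the letter j_l is tnth J (l-1), and drop l J is j_(l+1), ..., j_p. *)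
Definition is_P_finite (p : nat) (J : p.-tuple 'I_N) (z : R[i])
    H (pi : representation O H) : Prop :=
  exists Omega : H,
    [/\ `|Omega| = 1, cyclic_vector pi Omega,
        pi (\prod_(j <- J) s j) Omega = z *: Omega
      & orthonormal_family
          (fun l : 'I_p => pi (\prod_(j <- drop l J) s j) Omega)].

(* P(k); an infinite word is indexed from 0, so its n-th letter is k (n-1). *)
Definition is_P_infinite (k : nat -> 'I_N)
    H (pi : representation O H) : Prop :=
  exists Omega : H,
    [/\ `|Omega| = 1, cyclic_vector pi Omega
      & orthonormal_family
          (fun n => pi (\prod_(j <- rev (mkseq k n.+1)) star (s j)) Omega)].

End Representations.

Section Words.
Context {N : nat} (A : 'M[bool]_N).

Definition admissible_cycle (p : nat) (J : p.-tuple 'I_N) : Prop :=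
  path.cycle (fun i j => A i j) J.

Definition admissible_word (k : nat -> 'I_N) : Prop :=
  forall n, A (k n) (k n.+1).

End Words.

(* Z_p, the group generated by the cyclic shift of 'I_p. *)
Definition cyclic_perms (p : nat) : {group 'S_p} :=
  <[perm (@ordS_inj p)]>%G.

(* Main.v *)
From HB Require Import structures.
Require Import Defs.
From mathcomp Require Import all_boot all_order all_algebra all_fingroup.
From mathcomp Require Import sesquilinear complex zify ring lra.
From mathcomp Require Import all_classical all_reals all_analysis.

Set Implicit Arguments.
Unset Strict Implicit.
Unset Printing Implicit Defensive.

Import Order.TTheory GRing.Theory Num.Theory.
Import numFieldNormedType.Exports.

Local Open Scope classical_set_scope.
Local Open Scope ring_scope.

(** Write S_i for the image of the generator s_i.  The Cuntz-Krieger relations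
    make the ranges of the S_i orthogonal with sum H, so that a basis vector
    e_n of a permutative representation lies in exactly one of them: the adjoint
    of one S_i maps e_n to a phase times a basis vector e_(F n), and all the
    other adjoints kill it ([permutative_structure]).  Thus the basis carries a
    map F and a labelling by letters.  Two basis vectors generate the same
    cyclic subspace exactly when their F-orbits meet, which gives the
    decomposition of (i), and any decomposition along e must have these classes
    as its blocks, which gives its uniqueness ([permutative_decomposition],
    [decomposition_unique]).  The F-orbit of a cyclic basis vector is either
    eventually periodic, and the representation is P(J;z), or injective, and the
    representation is P(k) ([permutative_cyclic]).

    For (iii)-(vi), both P(J;z) and P(k) are described by one notion: a word K
    and vectors x_0, x_1, ... such that S_(K n) maps x_(n+1) to x_n and its
    adjoint maps x_n back to x_(n+1) ([chain]).  For P(J;z) the word repeats J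
    and x_(n+p) is the conjugate of z times x_n; for P(k) the x_n are
    orthonormal.  If x_0 is cyclic, the vectors S_I x_n, I a finite word, are
    total ([chain_total]), and their Gram matrix is determined by the word K
    and by the Gram matrix of the x_n ([gram_words]).  Families with the same
    Gram matrix are related by a unitary ([unitary_of_gram]), so equal tails of
    the words give equivalent representations ([chain_unitary]).

    Conversely, reading S_I x_n from the left along a word W, by applying the
    adjoints, either gives 0 or ends up in the chain, and then W ends like K
    ([chain_tail]).  An intertwiner carries the chain of one representation to
    a chain of the other one; it overlaps some S_I x_n, so that the words have
    a common tail and the overlap is constant along it ([tail_overlap]).  A
    constant overlap with an orthonormal sequence contradicts the Bessel
    inequality, which gives (iv); it fixes the phase in (v).  That the periods
    agree in (v) is a count of dimensions ([chain_span], [finite_equiv_le]):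
    in P(J;z), a chain with a periodic word consists of vectors in the span of
    the cycle.

    Irreducibility for an aperiodic word holds because the projections onto the
    prefixes of the word of x_n converge strongly to the projection onto x_n
    ([prefix_limit]).  If the word has a period that the vectors x_n do not
    have, [chain_unitary] produces a unitary of the commutant moving some x_m
    to an orthogonal vector, and the Schur lemma applies
    ([commutant_unitary]).

    Two analytic facts support this.  Representations are contractive
    ([rep_contractive]), so that invariance and intertwining can be checked on
    the generators ([invariant_of_generators], [intertwine_generators]), and the
    Schur lemma needs the absolute value of a self-adjoint contraction.  Both
    rest on the square root of 1 - h for a contraction h, obtained by iterating
    y |-> (h + y^2) / 2 from 0 ([picard]). *)

(** * Inner products, closed subspaces and bounded maps *)

Section Dot.
Context {R : realType} {H : hilbertType R}.
Implicit Types (u v w : H) (a : R[i]).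

Lemma dotC u v : dot u v = (dot v u)^*.
Proof. by rewrite hermC mul1r. Qed.

Lemma dotDl u v w : dot (u + v) w = dot u w + dot v w.
Proof. exact: linearDl. Qed.

Lemma dotDr u v w : dot u (v + w) = dot u v + dot u w.
Proof. exact: linearDr. Qed.

Lemma dotBl u v w : dot (u - v) w = dot u w - dot v w.
Proof. exact: linearBl. Qed.

Lemma dotBr u v w : dot u (v - w) = dot u v - dot u w.
Proof. exact: linearBr. Qed.

Lemma dotZl a u v : dot (a *: u) v = a * dot u v.
Proof. exact: linearZl_LR. Qed.

Lemma dotZr a u v : dot u (a *: v) = a^* * dot u v.
Proof. by rewrite linearZr_LR. Qed.

Lemma dot0l v : dot 0 v = 0.
Proof. exact: linear0l. Qed.

Lemma dot0r v : dot v 0 = 0.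
Proof. exact: linear0r. Qed.

Lemma dot_eq0 u : dot u u = 0 -> u = 0.
Proof. by move/eqP; rewrite dnorm_eq0 => /eqP. Qed.

Lemma dot_ge0 u : 0 <= dot u u.
Proof. exact: dnorm_ge0. Qed.

Lemma CauchySchwarz_dot u v : `|dot u v| <= `|u| * `|v|.
Proof.
rewrite -(@ler_pXn2r _ 2) ?nnegrE ?mulr_ge0 // exprMn -!dot_norm.
have [->|v0] := eqVneq v 0; first by rewrite !dot0r normr0 expr0n mulr0.
have vv : 0 < dot v v by rewrite dnorm_gt0.
have := dot_ge0 (u - (dot u v / dot v v) *: v).
rewrite dotBl dotZl !dotBr !dotZr [dot v u]dotC.
rewrite -/(dot u v / dot v v).
set a := _ / _.
have e : a * dot v v = dot u v by rewrite /a divfK ?gt_eqF.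
have -> : a * ((dot u v)^* - a^* * dot v v) = `|dot u v| ^+ 2 / dot v v - a^* * dot u v.
  by rewrite mulrBr normCK [a^* * _]mulrC mulrA e [X in X - _]mulrAC [_ * a^*]mulrC.
rewrite opprB addrA subrK.
by rewrite subr_ge0 ler_pdivrMr.
Qed.

End Dot.

(** Norms take values in R[i], which is not totally ordered; this replaces the
    usual comparison of a norm with 0. *)
Lemma norm_small {R : numDomainType} {V : normedZmodType R} (x : V) :
  (forall e, 0 < e -> `|x| < e) -> x = 0.
Proof.
move=> h; apply/eqP; apply: contraT => x0.
by have := h `|x|; rewrite normr_gt0 ltxx => /(_ x0).
Qed.

Lemma invn_lt {R : realType} (e : R[i]) : 0 < e -> exists n0 : nat,
  forall n, (n0 <= n)%N -> n.+1%:R^-1 < e.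
Proof.
case: e => a b; rewrite ltcE /= => /andP[/eqP-> a0].
have [n0 _ hn0] := near_infty_natSinv_lt (PosNum a0).
exists n0 => n /hn0 /=.
have -> : n.+1%:R^-1 = (n.+1%:R^-1 : R)%:C%C by rewrite fmorphV rmorph_nat.
by rewrite ltcR.
Qed.

Section Topology.
Context {R : realType} {H : hilbertType R}.
Implicit Types (u v w : H) (a : R[i]) (M : set H).

Lemma closure_approxP M v :
  closure M v <-> forall e : R[i], 0 < e -> exists2 u, M u & `|v - u| < e.
Proof.
split=> [cM e e0|h].
  have [u [Mu /=]] := cM _ (nbhsx_ballx v e e0).
  by rewrite -ball_normE /=; exists u.
move=> B /nbhs_ballP[e /= e0 Be].
by have [u Mu vu] := h e e0; exists u; split=> //; apply: Be; rewrite -ball_normE.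
Qed.

Lemma closed_approxP M :
  closed M <-> forall v, (forall e : R[i], 0 < e -> exists2 u, M u & `|v - u| < e) ->
    M v.
Proof.
split=> [cM v h|h]; first by apply: cM; apply/closure_approxP.
by move=> v /closure_approxP; apply: h.
Qed.

Definition seq_lim (x : nat -> H) l := forall e : R[i], 0 < e ->
  exists n0, forall n, (n0 <= n)%N -> `|l - x n| < e.

Lemma complete_seq (x : nat -> H) :
  (forall e : R[i], 0 < e -> exists n0, forall m n, (n0 <= m)%N -> (n0 <= n)%N ->
     `|x m - x n| < e) ->
  exists l, seq_lim x l.
Proof.
move=> cx.
have /cauchy_cvg/cvg_ex[l /cvg_ballP xl] : cauchy (x @ \oo).
  apply: cauchy_exP => e e0; have [n0 hn0] := cx e e0.
  exists (x n0); exists n0 => // n /= n0n.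
  by rewrite -ball_normE /=; apply: hn0.
exists l => e e0; have [n0 _ hn0] := xl e e0.
by exists n0 => n n0n; have := hn0 n n0n; rewrite /= -ball_normE.
Qed.

Lemma closed_subspace_approxP M :
  closed_subspace M <->
  [/\ M 0, forall a u v, M u -> M v -> M (a *: u + v) &
    forall v, (forall e : R[i], 0 < e -> exists2 u, M u & `|v - u| < e) -> M v].
Proof.
split=> [[[M0 Ml] /closed_approxP cM]|[M0 Ml cM]].
  split=> //; first by rewrite -in_setE.
  by move=> a u v Mu Mv; rewrite -in_setE; apply: Ml; rewrite in_setE.
split; last exact/closed_approxP.
split=> [|a u v]; first by rewrite in_setE.
by rewrite !in_setE; exact: Ml.
Qed.

Lemma closed_spanP (S : set H) : closed_subspace (closed_span S).
Proof.
apply/closed_subspace_approxP; split.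
- by move=> M [/closed_subspace_approxP[]].
- move=> a u v Mu Mv M SM; have /closed_subspace_approxP[_ Ml _] := SM.1.
  by apply: Ml; [exact: Mu|exact: Mv].
- move=> v h M SM; have /closed_subspace_approxP[_ _ cM] := SM.1.
  by apply: cM => e /h[u uS vu]; exists u => //; exact: uS.
Qed.

Lemma sub_closed_span (S : set H) u : S u -> closed_span S u.
Proof. by move=> Su M [_]; apply. Qed.

Lemma closed_span_sub (S M : set H) :
  closed_subspace M -> S `<=` M -> closed_span S `<=` M.
Proof. by move=> cM SM u; apply; split. Qed.

(** Addition and scaling are continuous: for a *: u + v the error on u is
    divided by 1 + |a|, which is nonzero even when a is 0. *)
Lemma closure_closed_subspace M : M 0 ->
  (forall a u v, M u -> M v -> M (a *: u + v)) -> closed_subspace (closure M).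
Proof.
move=> M0 Ml; split; last exact: closed_closure.
split; first by rewrite in_setE; apply: subset_closure.
move=> a u v; rewrite !in_setE => /closure_approxP cu /closure_approxP cv.
apply/closure_approxP => e e0.
have [u' Mu' uu'] := cu (e / 2 / (1 + `|a|)) ltac:(by rewrite !divr_gt0// ltr_wpDr).
have [v' Mv' vv'] := cv (e / 2) ltac:(by rewrite divr_gt0).
exists (a *: u' + v'); first exact: Ml.
rewrite opprD addrACA -scalerBr [e]splitr (le_lt_trans (ler_normD _ _))//.
rewrite ltr_leD// ?normrZ; last first.
  exact/ltW.
have a1 : 0 < 1 + `|a| by rewrite ltr_wpDr.
apply: le_lt_trans (_ : (1 + `|a|) * `|u - u'| < _).
  by rewrite ler_wpM2r// lerDr.
by rewrite mulrC -ltr_pdivlMr.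
Qed.

Lemma closed_subspaceZ M a u : closed_subspace M -> M u -> M (a *: u).
Proof.
move=> /closed_subspace_approxP[M0 Ml _] Mu.
by rewrite -[a *: u]addr0; apply: Ml.
Qed.

Lemma orthogonal_closed_subspace v : closed_subspace [set u | dot u v = 0].
Proof.
apply/closed_subspace_approxP; split=> /=; first exact: dot0l.
  by move=> a u w u0 w0; rewrite dotDl dotZl u0 w0 mulr0 addr0.
move=> w h; apply: norm_small => e e0.
have v1 : 0 < 1 + `|v| by rewrite ltr_wpDr.
have [u uv wu] := h (e / (1 + `|v|)) (divr_gt0 e0 v1).
rewrite -[dot w v]subr0 -uv -dotBl.
apply: le_lt_trans (CauchySchwarz_dot _ _) _.
apply: le_lt_trans (_ : `|w - u| * (1 + `|v|) < _).
  by rewrite ler_wpM2l// lerDr.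
by rewrite -ltr_pdivlMr.
Qed.

(** The orthogonal of a vector is a closed subspace; applied to u itself, it
    gives that u is orthogonal to u. *)
Lemma total_orthogonal (S : set H) u :
  closed_span S = setT -> (forall v, S v -> dot v u = 0) -> u = 0.
Proof.
move=> ST Su; apply: dot_eq0; have uS : closed_span S u by rewrite ST.
exact: closed_span_sub (orthogonal_closed_subspace u) Su _ uS.
Qed.

Lemma closed_span_orthogonal (S S' : set H) :
  (forall u v, S u -> S' v -> dot u v = 0) ->
  forall u v, closed_span S u -> closed_span S' v -> dot u v = 0.
Proof.
move=> SS' u v Su S'v.
apply: (closed_span_sub (orthogonal_closed_subspace v) _ Su) => {Su} {}u Su.
rewrite /= dotC; suff -> : dot v u = 0 by rewrite rmorph0.
apply: (closed_span_sub (orthogonal_closed_subspace u) _ S'v) => w S'w.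
by rewrite /= dotC SS'// rmorph0.
Qed.

End Topology.

Section Bounded.
Context {R : realType} {H H' : hilbertType R}.

(** The constant is required to be positive so that errors can be divided by
    it. *)
Definition bounded_by (C : R[i]) (f : H -> H') :=
  0 < C /\ forall u, `|f u| <= C * `|u|.

Lemma preimage_closed_subspace C (f : {linear H -> H'}) (M : set H') :
  bounded_by C f -> closed_subspace M -> closed_subspace (f @^-1` M).
Proof.
move=> [C0 fC] /closed_subspace_approxP[M0 Ml cM]; apply/closed_subspace_approxP; split.
- by rewrite /= linear0.
- by move=> a u v Mu Mv; rewrite /= linearP; apply: Ml.
- move=> v h; apply: cM => e e0.
  have [u Mu vu] := h (e / C) (divr_gt0 e0 C0).
  exists (f u) => //; rewrite -linearB (le_lt_trans (fC _))//.
  by rewrite mulrC -ltr_pdivlMr.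
Qed.

Lemma equalizer_closed_subspace C C' (f g : {linear H -> H'}) :
  bounded_by C f -> bounded_by C' g -> closed_subspace [set u | f u = g u].
Proof.
move=> [C0 fC] [C'0 gC]; apply/closed_subspace_approxP; split=> /=.
- by rewrite !linear0.
- by move=> a u v fu fv; rewrite !linearP fu fv.
- move=> v h; apply/eqP; rewrite -subr_eq0; apply/eqP; apply: norm_small => e e0.
  have CC : 0 < C + C' by rewrite addr_gt0.
  have [u fu vu] := h (e / (C + C')) (divr_gt0 e0 CC).
  have -> : f v - g v = f (v - u) - g (v - u).
    by rewrite (linearB f) (linearB g) fu opprB addrA subrK.
  rewrite (le_lt_trans (ler_normB _ _))//.
  rewrite (le_lt_trans (lerD (fC _) (gC _)))//.
  by rewrite -mulrDl mulrC -ltr_pdivlMr.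
Qed.

Lemma total_eq C C' (f g : {linear H -> H'}) (S : set H) :
  bounded_by C f -> bounded_by C' g -> closed_span S = setT ->
  (forall u, S u -> f u = g u) -> forall u, f u = g u.
Proof.
move=> fC gC ST fg u; have uS : closed_span S u by rewrite ST.
exact: closed_span_sub (equalizer_closed_subspace fC gC) fg _ uS.
Qed.

Lemma bounded_by_continuous C (f : {linear H -> H'}) : bounded_by C f -> continuous f.
Proof.
move=> [C0 fC] u; apply/cvg_ballP => e e0.
apply: filterS (nbhsx_ballx u _ (divr_gt0 e0 C0)) => v.
rewrite -!ball_normE /= -linearB => uv.
by rewrite (le_lt_trans (fC _))// mulrC -ltr_pdivlMr.
Qed.

End Bounded.

Section SeqLim.
Context {R : realType} {H : hilbertType R}.
Implicit Types (x y : nat -> H) (l : H).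

Lemma seq_lim_eq x l l' : seq_lim x l -> seq_lim x l' -> l = l'.
Proof.
move=> xl xl'; apply/eqP; rewrite -subr_eq0; apply/eqP; apply: norm_small => e e0.
have e2 := divr_gt0 e0 (ltr0Sn _ 1).
have [n1 h1] := xl _ e2; have [n2 h2] := xl' _ e2.
have := h1 _ (leq_maxl n1 n2); have := h2 _ (leq_maxr n1 n2).
set n := maxn _ _ => ln vn; rewrite [e]splitr -[l](subrK (x n)) -addrA.
by rewrite (le_lt_trans (ler_normD _ _))// ltrD// distrC.
Qed.

Lemma seq_limP a x y l l' : seq_lim x l -> seq_lim y l' ->
  seq_lim (fun n => a *: x n + y n) (a *: l + l').
Proof.
move=> xl yl e e0; have a1 : 0 < 1 + `|a| by rewrite ltr_wpDr.
have e2 := divr_gt0 e0 (ltr0Sn _ 1).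
have [n1 h1] := xl _ (divr_gt0 e2 a1); have [n2 h2] := yl _ e2.
exists (maxn n1 n2) => n; rewrite geq_max => /andP[/h1 xn /h2 yn].
rewrite opprD addrACA -scalerBr [e]splitr (le_lt_trans (ler_normD _ _))//.
rewrite ltrD// normrZ (@le_lt_trans _ _ ((1 + `|a|) * `|l - x n|))//.
  by rewrite ler_wpM2r// lerDr.
by rewrite mulrC -ltr_pdivlMr.
Qed.

Lemma seq_lim_norm x l c : seq_lim x l -> (forall n, `|x n| <= c) -> `|l| <= c.
Proof.
move=> xl xc; apply/ler_addgt0Pr => e e0; have [n /(_ n (leqnn _)) ln] := xl _ e0.
rewrite -[l](subrK (x n)) (le_trans (ler_normD _ _))// addrC lerD//.
exact: ltW.
Qed.

Lemma seq_lim_linear {H' : hilbertType R} C (f : {linear H -> H'}) x l :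
  bounded_by C f -> seq_lim x l -> forall e : R[i], 0 < e ->
  exists n0, forall n, (n0 <= n)%N -> `|f l - f (x n)| < e.
Proof.
move=> [C0 fC] xl e e0; have [n0 n0P] := xl _ (divr_gt0 e0 C0).
exists n0 => n /n0P xn; rewrite -linearB (le_lt_trans (fC _))//.
by rewrite mulrC -ltr_pdivlMr.
Qed.

Lemma seq_lim_succ x l : seq_lim x l -> seq_lim (fun n => x n.+1) l.
Proof.
by move=> xl e /xl[n0 n0P]; exists n0 => n n0n; apply/n0P/ltnW.
Qed.

End SeqLim.

Lemma bounded_by_comp {R : realType} {H H' H'' : hilbertType R} C C' (f : H -> H')
    (g : H' -> H'') :
  bounded_by C f -> bounded_by C' g -> bounded_by (C' * C) (g \o f).
Proof.
move=> [C0 fC] [C'0 gC']; split=> [|u /=]; first exact: mulr_gt0.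
by rewrite (le_trans (gC' _))// -mulrA ler_wpM2l// ltW.
Qed.

Section Isometry.
Context {R : realType} {H H' : hilbertType R} (V : {linear H -> H'}).
Hypothesis isoV : forall u v, dot (V u) (V v) = dot u v.

Lemma isometry_norm u : `|V u| = `|u|.
Proof.
by apply/eqP; rewrite -(@eqrXn2 _ 2)// -!dot_norm isoV.
Qed.

Lemma isometry_inj : injective V.
Proof.
move=> u v uv; apply/eqP; rewrite -subr_eq0 -normr_eq0 -isometry_norm linearB uv.
by rewrite subrr normr0.
Qed.

Lemma isometry_bounded : bounded_by 1 V.
Proof. by split=> // u; rewrite mul1r isometry_norm. Qed.

(** Preimages of a Cauchy sequence under an isometry form a Cauchy sequence,
    and the space is complete. *)
Lemma isometry_image_closed (M : set H) :
  closed_subspace M -> closed_subspace (V @` M).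
Proof.
move=> /closed_subspace_approxP[M0 Ml cM]; apply/closed_subspace_approxP; split.
- by exists 0 => //; rewrite linear0.
- move=> a _ _ [u Mu <-] [v Mv <-]; exists (a *: u + v); last by rewrite linearP.
  exact: Ml.
move=> v h.
have /choice[x xP] (n : nat) : exists u, M u /\ `|v - V u| < n.+1%:R^-1.
  by have [|_ [u Mu <-] vu] := h n.+1%:R^-1; [rewrite invr_gt0|exists u].
have x_cvg e : 0 < e -> exists n0 : nat, forall n, (n0 <= n)%N -> `|v - V (x n)| < e.
  move=> /invn_lt[n0 hn0]; exists n0 => n /hn0.
  exact: lt_trans (xP n).2.
have [l lP] : exists l, seq_lim x l.
  apply: complete_seq => e e0.
  have [n0 hn0] := x_cvg (e / 2) (divr_gt0 e0 (ltr0Sn _ _)).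
  exists n0 => m n /hn0 vm /hn0 vn.
  rewrite -isometry_norm linearB [e]splitr -[V (x m)](subrK v) -addrA.
  by rewrite (le_lt_trans (ler_normD _ _))// distrC ltrD.
have Ml0 : M l.
  apply: cM => e /lP[n hn]; exists (x n); first exact: (xP n).1.
  exact: hn.
exists l => //; apply/eqP; rewrite -subr_eq0; apply/eqP; apply: norm_small => e e0.
have e2 := divr_gt0 e0 (ltr0Sn _ 1).
have [n1 h1] := x_cvg _ e2; have [n2 h2] := lP _ e2.
have := h1 _ (leq_maxl n1 n2); have := h2 _ (leq_maxr n1 n2).
set n := maxn _ _ => ln vn; rewrite [e]splitr.
rewrite -[V l](subrK (V (x n))) -addrA (le_lt_trans (ler_normD _ _))//.
by rewrite -linearB isometry_norm [`|V _ - v|]distrC ltrD.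
Qed.

End Isometry.

(** * A closed subspace as a Hilbert space *)

Section SubHilbert.
Context {R : realType} {H : hilbertType R} (M : set H).

(** The type depends on the proof that M is a closed subspace, because
    completeness of the structure comes from it. *)
Record sub_hilbert (cM : closed_subspace M) := SubHilbert {
  sub_val : H;
  sub_valP : sub_val \in mem M }.

Variable cM : closed_subspace M.
Local Notation W := (sub_hilbert cM).

HB.instance Definition _ := [isSub for @sub_val cM].
HB.instance Definition _ := [Choice of W by <:].

Let submodM : subsemimod_closed (mem M) := GRing.submod_closed_semi cM.1.

HB.instance Definition _ :=
  GRing.SubChoice_isSubLmodule.Build R[i] H (mem M) W submodM.

Let sub_norm (u : W) : R[i] := `|\val u|.

Let sub_normD u v : sub_norm (u + v) <= sub_norm u + sub_norm v.
Proof. by rewrite /sub_norm raddfD ler_normD. Qed.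

Let sub_normZ a u : sub_norm (a *: u) = `|a| * sub_norm u.
Proof. by rewrite /sub_norm linearZ normrZ. Qed.

Let sub_norm_eq0 u : sub_norm u = 0 -> u = 0.
Proof. by move/eqP; rewrite normr_eq0 => /eqP u0; apply: val_inj; rewrite u0 raddf0. Qed.

HB.instance Definition _ :=
  Lmodule_isNormed.Build R[i] W sub_normD sub_normZ sub_norm_eq0.

Lemma sub_hilbert_norm (u : W) : `|u| = `|\val u|.
Proof. by []. Qed.

Let sub_complete (F : set_system W) : ProperFilter F -> cauchy F -> cvg F.
Proof.
move=> PF /cauchyP cF.
have valB (u v : W) (e : R[i]) : ball (\val u) e (\val v) <-> ball u e v.
  by rewrite -!ball_normE /= sub_hilbert_norm raddfB.
have /cauchy_cvg/cvg_ex[l /cvg_ballP Fl] : cauchy (\val @ F).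
  apply: cauchy_exP => e e0; have [x Fx] := cF e e0.
  exists (\val x); suff : F [set y | ball (\val x) e (\val y)] by [].
  by apply: filterS Fx => y /valB.
have Ml : l \in mem M.
  rewrite in_setE; have /closed_subspace_approxP[_ _] := cM; apply=> e e0.
  have /filter_ex[u lu] : F [set u | ball l e (\val u)] by exact: Fl.
  exists (\val u); last by move: lu; rewrite -ball_normE.
  by have := valP u; rewrite in_setE.
apply/cvg_ex; exists (Sub l Ml); apply/cvg_ballP => e e0.
have : F [set u | ball l e (\val u)] by exact: Fl.
by apply: filterS => u /= lu; apply/valB.
Qed.

HB.instance Definition _ := Uniform_isComplete.Build W sub_complete.

Let sub_dot (u v : W) : R[i] := dot (\val u) (\val v).

Let sub_dot_bilinear : bilinear_for ( *%R ) (Num.conj \; *%R) sub_dot.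
Proof.
split=> [v a u u'|v a u u']; rewrite /sub_dot /=.
  by rewrite dotDl dotZl.
by rewrite dotDr dotZr.
Qed.

HB.instance Definition _ :=
  bilinear_isBilinear.Build R[i] W W R[i] ( *%R ) (Num.conj \; *%R) sub_dot
    sub_dot_bilinear.

Let sub_dotC u v : sub_dot u v = (-1) ^+ false * Num.conj (sub_dot v u).
Proof. by rewrite mul1r -dotC. Qed.

HB.instance Definition _ :=
  isHermitianSesquilinear.Build R[i] W false Num.conj sub_dot sub_dotC.

Let sub_dot_gt0 u : u != 0 -> 0 < sub_dot u u.
Proof.
move=> u0; rewrite dnorm_gt0; apply: contra u0 => /eqP u0.
by apply/eqP/val_inj; rewrite u0 raddf0.
Qed.

HB.instance Definition _ :=
  isDotProduct.Build R[i] W sub_dot sub_dot_gt0.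

Let sub_dot_norm (u : W) : (sub_dot : {dot W for Num.conj}) u u = `|u| ^+ 2.
Proof. by rewrite sub_hilbert_norm -dot_norm. Qed.

HB.instance Definition _ :=
  CompleteNormedModule_isHilbert.Build R W sub_dot_norm.

Lemma sub_hilbert_dot (u v : W) : dot u v = dot (\val u) (\val v).
Proof. by []. Qed.

Definition sub_incl : W -> H := \val.
HB.instance Definition _ := GRing.Linear.copy sub_incl (\val : W -> H).
End SubHilbert.

(** * Unitaries between families with equal Gram matrices *)

Section Gram.
Context {R : realType} {H H' : hilbertType R} {I : Type}.
Context (f : I -> H) (g : I -> H').

(** The linear relation spanned by the pairs (f i, g i).  Equality of the Gram
    matrices of f and g makes it isometric, hence the graph of a partial
    isometry. *)
Inductive span_rel : H -> H' -> Prop :=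
| span_rel0 : span_rel 0 0
| span_relS a i u v : span_rel u v -> span_rel (a *: f i + u) (a *: g i + v).

Lemma span_relP a u v u' v' :
  span_rel u v -> span_rel u' v' -> span_rel (a *: u + u') (a *: v + v').
Proof.
move=> uv uv'; elim: uv => [|b i x y _ IH]; first by rewrite !scaler0 !add0r.
by rewrite !scalerDr !scalerA -!addrA; constructor.
Qed.

Lemma span_rel_dense : closed_span (range f) = setT ->
  forall u e, 0 < e -> exists u' v', span_rel u' v' /\ `|u - u'| < e.
Proof.
move=> fT u e e0.
have cS : closed_subspace (closure [set u | exists v, span_rel u v]).
  apply: closure_closed_subspace; first by exists 0; constructor.
  move=> a x y [x' xx'] [y' yy']; exists (a *: x' + y'); exact: span_relP.
have uf : closed_span (range f) u by rewrite fT.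
have fS : range f `<=` closure [set u | exists v, span_rel u v].
  move=> _ [i _ <-]; apply: subset_closure; exists (g i).
  rewrite -[f i]scale1r -[g i]scale1r -[_ *: f i]addr0 -[_ *: g i]addr0.
  by do 2!constructor.
have [u' [v' uv'] uu'] := (closure_approxP _ _).1 (closed_span_sub cS fS uf) e e0.
by exists u', v'.
Qed.

Hypothesis fg : forall i j, dot (f i) (f j) = dot (g i) (g j).

Lemma span_rel_dot u v u' v' :
  span_rel u v -> span_rel u' v' -> dot u u' = dot v v'.
Proof.
move=> uv uv'; elim: uv => [|a i x y _ IH]; first by rewrite !dot0l.
rewrite !dotDl !dotZl IH; congr (_ * _ + _) => {x y IH}.
elim: uv' => [|b j x y _ IH]; first by rewrite !dot0r.
by rewrite !dotDr !dotZr IH fg.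
Qed.

Lemma span_rel_norm u v : span_rel u v -> `|u| = `|v|.
Proof.
by move=> uv; apply/eqP; rewrite -(@eqrXn2 _ 2)// -!dot_norm (span_rel_dot uv uv).
Qed.

Lemma span_rel_normB u v u' v' :
  span_rel u v -> span_rel u' v' -> `|u - u'| = `|v - v'|.
Proof.
move=> uv uv'; apply: span_rel_norm.
by rewrite addrC [v - v']addrC -[- u']scaleN1r -[- v']scaleN1r; apply: span_relP.
Qed.

(** The closure of the graph, hence again an isometric relation. *)
Definition lim_rel u v := forall e, 0 < e ->
  exists u' v', [/\ span_rel u' v', `|u - u'| < e & `|v - v'| < e].

Lemma lim_relP a u v u' v' :
  lim_rel u v -> lim_rel u' v' -> lim_rel (a *: u + u') (a *: v + v').
Proof.
move=> uv uv' e e0; have a1 : 0 < 1 + `|a| by rewrite ltr_wpDr.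
have e2 := divr_gt0 e0 (ltr0Sn _ 1).
have [x [y [xy ux vy]]] := uv _ (divr_gt0 e2 a1).
have [x' [y' [xy' ux' vy']]] := uv' _ e2.
exists (a *: x + x'), (a *: y + y'); split; first exact: span_relP.
  rewrite opprD addrACA -scalerBr [e]splitr (le_lt_trans (ler_normD _ _))//.
  rewrite ltrD// normrZ (@le_lt_trans _ _ ((1 + `|a|) * `|u - x|))//.
    by rewrite ler_wpM2r// lerDr.
  by rewrite mulrC -ltr_pdivlMr.
rewrite opprD addrACA -scalerBr [e]splitr (le_lt_trans (ler_normD _ _))//.
rewrite ltrD// normrZ (@le_lt_trans _ _ ((1 + `|a|) * `|v - y|))//.
  by rewrite ler_wpM2r// lerDr.
by rewrite mulrC -ltr_pdivlMr.
Qed.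

Lemma lim_rel_norm u v : lim_rel u v -> `|u| = `|v|.
Proof.
move=> uv; apply/eqP; rewrite -subr_eq0; apply/eqP; apply: norm_small => e e0.
have [x [y [xy ux vy]]] := uv _ (divr_gt0 e0 (ltr0Sn _ 1)).
have -> : `|u| - `|v| = (`|u| - `|x|) - (`|v| - `|y|).
  by rewrite (span_rel_norm xy) opprB addrA subrK.
rewrite [e]splitr (le_lt_trans (ler_normB _ _))// ltrD//.
  exact: le_lt_trans (ler_dist_dist _ _) ux.
exact: le_lt_trans (ler_dist_dist _ _) vy.
Qed.

Lemma lim_rel_total : closed_span (range f) = setT -> forall u, exists v, lim_rel u v.
Proof.
move=> fT u.
have /choice[x xP] (n : nat) : exists xy : H * H',
    span_rel xy.1 xy.2 /\ `|u - xy.1| < n.+1%:R^-1.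
  have [|x [y [xy ux]]] := span_rel_dense fT u (_ : 0 < n.+1%:R^-1).
    by rewrite invr_gt0.
  by exists (x, y).
have x_cvg e : 0 < e -> exists n0 : nat, forall n, (n0 <= n)%N -> `|u - (x n).1| < e.
  move=> /invn_lt[n0 hn0]; exists n0 => n /hn0.
  exact: lt_trans (xP n).2.
have [l lP] : exists l, seq_lim (fun n => (x n).2) l.
  apply: complete_seq => e e0.
  have [n0 hn0] := x_cvg (e / 2) (divr_gt0 e0 (ltr0Sn _ _)).
  exists n0 => m n /hn0 vm /hn0 vn.
  rewrite -(span_rel_normB (xP m).1 (xP n).1) [e]splitr -[(x m).1](subrK u) -addrA.
  by rewrite (le_lt_trans (ler_normD _ _))// distrC ltrD.
exists l => e e0; have [n1 h1] := x_cvg _ e0; have [n2 h2] := lP _ e0.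
have := h1 _ (leq_maxl n1 n2); have := h2 _ (leq_maxr n1 n2).
set n := maxn _ _ => ln vn; exists (x n).1, (x n).2; split=> //.
exact: (xP n).1.
Qed.

End Gram.

Section Polarization.
Context {R : realType} {H H' : hilbertType R}.

(** Polarization, with u and with i *: u in place of u. *)
Lemma norm_preserving_dot (V : {linear H -> H'}) :
  (forall u, `|V u| = `|u|) -> forall u v, dot (V u) (V v) = dot u v.
Proof.
move=> nV.
have h u v : dot (V u) (V v) + (dot (V u) (V v))^* = dot u v + (dot u v)^*.
  have := congr1 (fun x => x ^+ 2) (nV (u + v)).
  by rewrite -!dot_norm linearD !dnormD !dot_norm !nV => /addrI.
have iE (x : R[i]) : 'i * x + ('i * x)^* = 'i * (x - x^*).
  by rewrite rmorphM /= conjCi mulNr mulrBr.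
move=> u v; have h1 := h u v; have := h ('i *: u) v.
rewrite linearZ /= !dotZl !iE => /(mulfI (neq0Ci _)) h2.
apply: (mulfI (_ : (2 : R[i]) != 0)); first by rewrite pnatr_eq0.
rewrite !mulr_natl !mulr2n.
transitivity ((dot (V u) (V v) + (dot (V u) (V v))^*) +
  (dot (V u) (V v) - (dot (V u) (V v))^*)).
  by rewrite addrACA subrr addr0.
by rewrite h1 h2 addrACA subrr addr0.
Qed.

(** The closure of the linear relation spanned by the pairs (f i, g i) is an
    isometric graph; it is total on both sides since f and g are total. *)
Lemma unitary_of_gram {I : Type} (f : I -> H) (g : I -> H') :
  (forall i j, dot (f i) (f j) = dot (g i) (g j)) ->
  closed_span (range f) = setT -> closed_span (range g) = setT ->
  exists U : {linear H -> H'},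
    [/\ forall u v, dot (U u) (U v) = dot u v,
        forall v, exists u, U u = v
      & forall i, U (f i) = g i].
Proof.
move=> fg fT gT.
have lim_fun u v w : lim_rel f g u v -> lim_rel f g u w -> v = w.
  move=> uv uw; have := lim_rel_norm fg (lim_relP (-1) uw uv).
  rewrite !scaleN1r addNr normr0 => /esym/eqP; rewrite normr_eq0 addrC subr_eq0.
  by move/eqP.
have /choice[U0 U0P] := lim_rel_total fg fT.
have U0l : linear U0.
  by move=> a u v; apply: lim_fun (U0P _) _; apply: lim_relP.
pose U : {linear H -> H'} := HB.pack U0 (GRing.isLinear.Build _ _ _ _ U0 U0l).
exists U; split.
- by apply: norm_preserving_dot => u; rewrite -(lim_rel_norm fg (U0P u)).
- move=> v.
  have [u vu] := lim_rel_total (fun i j => esym (fg i j)) gT v.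
  exists u; apply: lim_fun (U0P u) _ => e /vu[y [x [yx vy ux]]].
  exists x, y; split=> //; elim: yx => [|a i y' x' _ IH]; by constructor.
- move=> i; apply: lim_fun (U0P _) _ => e e0.
  exists (f i), (g i); rewrite !subrr !normr0; split=> //.
  rewrite -[f i]scale1r -[g i]scale1r -[_ *: f i]addr0 -[_ *: g i]addr0.
  by do 2!constructor.
Qed.

End Polarization.

Lemma unitary_inverse {R : realType} {H H' : hilbertType R} (U : {linear H -> H'}) :
  (forall u v, dot (U u) (U v) = dot u v) -> (forall v, exists u, U u = v) ->
  exists W : {linear H' -> H}, (forall u, W (U u) = u) /\ (forall v, U (W v) = v).
Proof.
move=> isoU surU; have injU := isometry_inj isoU.
have /choice[W0 UW] := surU.
have W0l : linear W0 by move=> a u v; apply: injU; rewrite linearP !UW.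
pose W : {linear H' -> H} := HB.pack W0 (GRing.isLinear.Build _ _ _ _ W0 W0l).
by exists W; split=> // u; apply: injU; rewrite UW.
Qed.

(** * Square roots and contractivity of representations *)

Section Picard.
Context {R : realType}.

(** The iteration y |-> (1 + y^2) / 2 from 0; it increases to the fixed point
    1 and dominates the norms of the iterates of picard. *)
Fixpoint sqrt_majorant n : R :=
  if n is m.+1 then (1 + sqrt_majorant m ^+ 2) / 2 else 0.
Local Notation Y := sqrt_majorant.

(** With d := 1 - Y n the recursion is d |-> d - d^2 / 2, and d <= 2 / (n + 2)
    propagates because (n + 1) (n + 3) <= (n + 2)^2. *)
Lemma sqrt_majorant_bounds n : 0 <= Y n /\ 0 <= 1 - Y n <= 2 / n.+2%:R.
Proof.
elim: n => [|n [Y0 /andP[Y1 Yn]]] /=; first by split; lra.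
have n2 : (0 : R) < n.+2%:R by [].
have n3 : (0 : R) < n.+3%:R by [].
have nE : n.+3%:R = n.+2%:R + 1 :> R by rewrite -natr1.
split; first nra.
apply/andP; split; first nra.
move: Yn; rewrite ler_pdivlMr// => Yn.
rewrite ler_pdivlMr// nE.
set a := n.+2%:R in n2 Yn *; set d := 1 - Y n in Y1 Yn.
have -> : 1 - (1 + Y n ^+ 2) / 2 = d - d ^+ 2 / 2.
  have -> : Y n = 1 - d by rewrite /d opprB addrC subrK.
  by field.
have d1 : d <= 1 by rewrite /d; lra.
have : 0 <= (2 - d * a) * (1 - d / 2) by apply: mulr_ge0; lra.
have : 0 <= d ^+ 2 by apply: sqr_ge0.
nra.
Qed.

Context {V : lmodType R[i]} (nu : V -> R[i]).
Hypothesis nuD : forall u v, nu (u + v) <= nu u + nu v.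
Hypothesis nuZ : forall a u, nu (a *: u) = `|a| * nu u.

Lemma seminorm0 : nu 0 = 0.
Proof. by rewrite -(scale0r 0) nuZ normr0 mul0r. Qed.

Lemma seminorm_ge0 u : 0 <= nu u.
Proof.
have := nuD u (- u); rewrite subrr seminorm0 -scaleN1r nuZ normrN1 mul1r -mulr2n.
by rewrite pmulrn_lge0.
Qed.

Context (h : {linear V -> V}).
Hypothesis h_contr : forall u, nu (h u) <= nu u.

(** The powers are compositions, so that the same iteration serves in an
    algebra, through left multiplications, and on operators of a Hilbert
    space, pointwise.  A fixed point y satisfies (1 - y)^2 = 1 - h. *)
Fixpoint picard n (u : V) : V :=
  if n is m.+1 then 2^-1 *: (h u + picard m (picard m u)) else 0.

Lemma picardP n a u v : picard n (a *: u + v) = a *: picard n u + picard n v.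
Proof.
elim: n u v a => [|n IH] u v a /=; first by rewrite scaler0 addr0.
rewrite linearP !IH scalerA [a * _]mulrC -scalerA -scalerDr; congr (_ *: _).
by rewrite addrACA -scalerDr.
Qed.

Lemma picardB n u v : picard n (u - v) = picard n u - picard n v.
Proof. by rewrite addrC -scaleN1r picardP scaleN1r addrC. Qed.

Lemma half_norm : `|2^-1 : R[i]| = 2^-1.
Proof. by rewrite ger0_norm// invr_ge0. Qed.

Lemma majorant_succ n : (Y n.+1)%:C%C = 2^-1 * (1 + (Y n)%:C%C ^+ 2) :> R[i].
Proof. by rewrite /= rmorphM rmorphD rmorph1 rmorphXn fmorphV rmorph_nat mulrC. Qed.

Lemma majorant_ge0 n : 0 <= (Y n)%:C%C :> R[i].
Proof. by rewrite -[0](rmorph0 (real_complex R)) lecR; have [] := sqrt_majorant_bounds n. Qed.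

Lemma picard_le n u : nu (picard n u) <= (Y n)%:C%C * nu u.
Proof.
elim: n u => [|n IH] u; first by rewrite /= seminorm0 rmorph0 mul0r.
rewrite majorant_succ [picard _ _]/= nuZ half_norm -mulrA ler_wpM2l ?invr_ge0//.
rewrite (le_trans (nuD _ _))// mulrDl mul1r lerD// expr2 -mulrA.
by rewrite (le_trans (IH _))// ler_wpM2l ?majorant_ge0.
Qed.

(** With P and p two successive iterates, P^2 - p^2 = (P - p) p + P (P - p);
    the majorant satisfies the same identity. *)
Lemma picard_step n u :
  nu (picard n.+1 u - picard n u) <= ((Y n.+1)%:C%C - (Y n)%:C%C) * nu u.
Proof.
elim: n u => [|n IH] u.
  rewrite [picard 0 u]/= subr0 [_ 0]/= [X in _ - X]rmorph0 subr0.
  exact: picard_le.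
rewrite [X in _ <= X * _](_ : _ = 2^-1 * (((Y n.+1)%:C%C - (Y n)%:C%C) *
   (Y n)%:C%C + (Y n.+1)%:C%C * ((Y n.+1)%:C%C - (Y n)%:C%C))); last first.
  by rewrite [(Y n.+2)%:C%C]majorant_succ {2}majorant_succ; ring.
set P := picard n.+1 in IH *.
have -> : picard n.+2 u - P u = 2^-1 *: ((P (picard n u) - picard n (picard n u)) +
    P (P u - picard n u)).
  rewrite [picard n.+2 u]/= -/P [P u in X in _ - X]/P [picard n.+1 u in X in _ - X]/=.
  rewrite -scalerBr /P picardB -/P; congr (_ *: _).
  rewrite opprD addrACA subrr add0r [RHS]addrC addrA subrK.
  by [].
rewrite nuZ half_norm -[leRHS]mulrA ler_wpM2l ?invr_ge0//.
have d0 : 0 <= (Y n.+1)%:C%C - (Y n)%:C%C :> R[i].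
  rewrite -rmorphB -[0](rmorph0 (real_complex R)) lecR /=.
  by have [y0 /andP[y1 _]] := sqrt_majorant_bounds n; nra.
rewrite (le_trans (nuD _ _))// mulrDl lerD//.
  rewrite (le_trans (IH _))// -mulrA ler_wpM2l// (le_trans (picard_le _ _))//.
rewrite (le_trans (picard_le _ _))// -mulrA ler_wpM2l ?majorant_ge0//.
Qed.

Lemma picard_cauchy m n u : (n <= m)%N ->
  nu (picard m u - picard n u) <= 2 / n.+2%:R * nu u.
Proof.
move=> nm; apply: (@le_trans _ _ (((Y m)%:C%C - (Y n)%:C%C) * nu u)); last first.
  rewrite ler_wpM2r ?seminorm_ge0//.
  have -> : 2 / n.+2%:R = (2 / n.+2%:R : R)%:C%C :> R[i].
    by rewrite rmorphM fmorphV !rmorph_nat.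
  rewrite -rmorphB lecR.
  have [_ /andP[_ h1]] := sqrt_majorant_bounds n.
  have [_ /andP[h2 _]] := sqrt_majorant_bounds m.
  by rewrite (le_trans _ h1)// lerD2r -subr_ge0.
elim: m nm => [|m IH]; first by rewrite leqn0 => /eqP ->; rewrite !subrr mul0r seminorm0.
rewrite leq_eqVlt => /orP[/eqP->|]; first by rewrite !subrr mul0r seminorm0.
rewrite ltnS => /IH {}IH.
rewrite -[picard m.+1 u](subrK (picard m u)) -addrA (le_trans (nuD _ _))//.
rewrite -[(Y m.+1)%:C%C](subrK (Y m)%:C%C) -addrA mulrDl lerD//.
exact: picard_step.
Qed.

End Picard.

Lemma picard_rate_small {R : realType} (e c : R[i]) : 0 < e -> 0 <= c ->
  exists n0 : nat, forall n, (n0 <= n)%N -> 2 / n.+2%:R * c < e.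
Proof.
move=> e0 c0; have c1 : 0 < 2 * (c + 1) by rewrite mulr_gt0// ltr_wpDl.
have [n0 hn0] := invn_lt (divr_gt0 e0 c1).
exists n0 => n n0n; have := hn0 n.+1 (leq_trans n0n (leqnSn _)).
rewrite ltr_pdivlMr// => h; apply: le_lt_trans h.
rewrite [_ / _]mulrC -mulrA ler_wpM2l ?invr_ge0// ler_wpM2l//.
by rewrite lerDl.
Qed.

Section CstarSqrt.
Context {R : realType} {B : cstarAlgType R}.
Implicit Types x y : B.

Lemma cnorm0 : cnorm (0 : B) = 0.
Proof. exact: seminorm0 (@cnormZ R B). Qed.

Lemma cnorm_ge0 x : 0 <= cnorm x.
Proof. exact: seminorm_ge0 (@cnormD R B) (@cnormZ R B) x. Qed.

Lemma cnormN x : cnorm (- x) = cnorm x.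
Proof. by rewrite -scaleN1r cnormZ normrN1 mul1r. Qed.

Lemma cnormBC x y : cnorm (x - y) = cnorm (y - x).
Proof. by rewrite -cnormN opprB. Qed.

Lemma cnorm_small x : (forall e, 0 < e -> cnorm x < e) -> x = 0.
Proof.
move=> h; apply: cnorm_eq0; apply/eqP; rewrite -normr_eq0 ger0_norm ?cnorm_ge0//.
apply/eqP; apply: norm_small => e /h; rewrite ger0_norm ?cnorm_ge0//.
Qed.

Lemma starP a x y : star (a *: x + y) = a^* *: star x + star y :> B.
Proof. by rewrite starD starZ. Qed.

Lemma star0 : star 0 = 0 :> B.
Proof. by have := @starZ R B 0 0; rewrite conjC0 !scale0r. Qed.

Lemma starB x y : star (x - y) = star x - star y.
Proof. by rewrite addrC -scaleN1r starP rmorphN rmorph1 scaleN1r addrC. Qed.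

Lemma star1 : star 1 = 1 :> B.
Proof. by have := @starM R B (star 1) 1; rewrite !starK !mulr1 starK => <-. Qed.

(** By the C*-identity the square of the norm of x is at most the product of
    the norms of star x and x. *)
Lemma cnorm_starE x : cnorm (star x) = cnorm x.
Proof.
have le y : cnorm y <= cnorm (star y).
  have [->|y0] := eqVneq (cnorm y) 0; first exact: cnorm_ge0.
  have y1 : 0 < cnorm y by rewrite lt_def y0 cnorm_ge0.
  by have := cnormM (star y) y; rewrite cnorm_star expr2 ler_pM2r.
by apply/le_anti; rewrite le andbT -{2}[x]starK le.
Qed.

(** The iterates are self-adjoint polynomials in h, and their limit y
    satisfies y = (h + y^2) / 2. *)
Lemma cstar_sqrt (h : B) : star h = h -> cnorm h <= 1 ->
  exists y : B, star y = y /\ (1 - y) * (1 - y) = 1 - h.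
Proof.
move=> hs h1; pose L : {linear B -> B} := GRing.mull_fun h idfun.
have L_contr u : cnorm (L u) <= cnorm u.
  by rewrite (le_trans (cnormM _ _))// ler_piMl ?cnorm_ge0.
have rate m n u (nm : (n <= m)%N) :=
  picard_cauchy (@cnormD R B) (@cnormZ R B) L_contr u nm.
pose x n := picard L n 1.
have xE n u : picard L n u = x n * u.
  rewrite /x; elim: n u => [|n IH] u /=; first by rewrite mul0r.
  by rewrite (IH (picard _ _ u)) (IH u) (IH (picard _ _ 1)) mulr1 mulrA -scalerAl mulrDl.
have xS n : x n.+1 = 2^-1 *: (h + x n * x n) by rewrite -xE /x /= mulr1.
have xs n : star (x n) = x n.
  elim: n => [|n IH]; first exact: star0.
  by rewrite xS starZ starD hs starM IH conj_Creal// realE invr_ge0 ler0n.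
have [y yP] : exists y, forall e : R[i], 0 < e ->
    exists n0, forall n, (n0 <= n)%N -> cnorm (x n - y) < e.
  have [|y yP] := @cnorm_complete R B x; last first.
    by exists y => e /yP[n0 _ n0P]; exists n0 => n /n0P.
  move=> e e0; have e2 := divr_gt0 e0 (ltr0Sn _ 1).
  have [n0 n0P] := picard_rate_small e2 (cnorm_ge0 1).
  have r k : (n0 <= k)%N -> cnorm (x k - x n0) < e / 2.
    by move=> /rate r; exact: le_lt_trans (r _) (n0P _ (leqnn _)).
  exists ([set n | (n0 <= n)%N], [set n | (n0 <= n)%N]).
    by split; exists n0.
  case=> m n /= [/r n0m /r n0n]; rewrite [e]splitr.
  rewrite -[x m](subrK (x n0)) -addrA (le_lt_trans (cnormD _ _))//.
  by rewrite ltrD// cnormBC.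
exists y; split.
  apply/eqP; rewrite -subr_eq0; apply/eqP; apply: cnorm_small => e e0.
  have [n0 /(_ n0 (leqnn _))] := yP _ (divr_gt0 e0 (ltr0Sn _ 1)).
  rewrite -[star y](subrK (x n0)) -addrA => yn0.
  rewrite [e]splitr (le_lt_trans (cnormD _ _))// ltrD//.
  by rewrite -{1}xs -starB cnorm_starE cnormBC.
suff yE : y *+ 2 - (h + y * y) = 0.
  have -> : h = y + (y - y * y).
    by apply/esym/eqP; rewrite addrA -mulr2n subr_eq -subr_eq0 yE.
  by rewrite mulrBr mulr1 mulrBl mul1r [in RHS]opprD addrA.
apply: cnorm_small => e e0.
(* C bounds the error in y^2 - 2 y + h relative to that in y, as long as the
   latter is at most 1; taking d = e / (e + C) ensures both d <= 1 and C d < e. *)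
pose C := 2 + (1 + 2 * cnorm y); have C0 : 0 < C.
  by rewrite ltr_wpDr// addr_ge0// mulr_ge0// cnorm_ge0.
have eC : 0 < e + C by rewrite addr_gt0.
have d0 : 0 < e / (e + C) by rewrite divr_gt0.
have [n0 n0P] := yP _ d0; set d := e / (e + C) in d0 n0P.
have d1 : d <= 1 by rewrite ler_pdivrMr// mul1r lerDl ltW.
have xn := n0P _ (leqnn n0); have xn1 := n0P _ (leqnSn n0).
have -> : y *+ 2 - (h + y * y) = 2 *: (y - x n0.+1) +
   ((x n0 - y) * x n0 + y * (x n0 - y)).
  rewrite scalerBr xS scalerA mulfV ?pnatr_eq0// scale1r scaler_nat.
  have -> : (x n0 - y) * x n0 + y * (x n0 - y) = x n0 * x n0 - y * y.
    by rewrite mulrBl mulrBr addrA subrK.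
  by rewrite !opprD !addrA subrK.
have xle : cnorm (x n0) <= 1 + cnorm y.
  rewrite -[x n0](subrK y) (le_trans (cnormD _ _))// lerD2r.
  exact: le_trans (ltW xn) d1.
rewrite (le_lt_trans (cnormD _ _))// cnormZ ger0_norm//.
apply: (@le_lt_trans _ _ (2 * d + (d * (1 + cnorm y) + cnorm y * d))).
  apply: lerD; first by rewrite ler_wpM2l// cnormBC ltW.
  rewrite (le_trans (cnormD _ _))// lerD// (le_trans (cnormM _ _))//.
    by rewrite ler_pM ?cnorm_ge0// ltW.
  by rewrite ler_wpM2l ?cnorm_ge0// ltW.
have -> : 2 * d + (d * (1 + cnorm y) + cnorm y * d) = e * (C / (e + C)).
  by rewrite /d /C; field; rewrite gt_eqF.
by rewrite gtr_pMr// ltr_pdivrMr// mul1r ltrDr.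
Qed.

End CstarSqrt.

Section Contractive.
Context {R : realType} {O : cstarAlgType R} {H : hilbertType R}.
Variable pi : representation O H.

Lemma repB x y u : pi (x - y) u = pi x u - pi y u.
Proof. by rewrite addrC -scaleN1r rep_linear scaleN1r addrC. Qed.

Lemma rep0 u : pi 0 u = 0.
Proof. by rewrite -(subrr 0) repB subrr. Qed.

Lemma repZ a x u : pi (a *: x) u = a *: pi x u.
Proof. by rewrite -[a *: x]addr0 rep_linear rep0 addr0. Qed.

Lemma repD x y u : pi (x + y) u = pi x u + pi y u.
Proof. by rewrite -[x]scale1r rep_linear !scale1r. Qed.

Lemma rep_sum I (r : seq I) (F : I -> O) u :
  pi (\sum_(i <- r) F i) u = \sum_(i <- r) pi (F i) u.
Proof. by elim: r => [|i r IH]; rewrite ?big_nil ?rep0// !big_cons repD IH. Qed.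

Lemma rep_starl x u v : dot (pi (star x) u) v = dot u (pi x v).
Proof. by rewrite rep_star starK. Qed.

(** If the norm of x is at most 1, then 1 - star x * x is a square of a
    self-adjoint element by cstar_sqrt, so its image under pi is a positive
    operator: the norm of pi x u is at most that of u. *)
Lemma rep_contractive x u : `|pi x u| <= cnorm x * `|u|.
Proof.
have small y : cnorm y <= 1 -> `|pi y u| <= `|u|.
  move=> y1; have [||w [ws wE]] := @cstar_sqrt R O (star y * y).
  - by rewrite starM starK.
  - by rewrite cnorm_star exprn_ile1 ?cnorm_ge0.
  rewrite -(@ler_pXn2r _ 2) ?nnegrE// -!dot_norm rep_star -rep_mul.
  have := dot_ge0 (pi (1 - w) u).
  rewrite rep_star -rep_mul starB star1 ws wE repB rep_one dotBr subr_ge0.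
  by [].
have [x0|x0] := eqVneq (cnorm x) 0.
  by rewrite (cnorm_eq0 _ x0) rep0 normr0 cnorm0 mul0r.
have x1 : 0 < cnorm x by rewrite lt_def x0 cnorm_ge0.
have := small ((cnorm x)^-1 *: x).
rewrite cnormZ ger0_norm ?invr_ge0 ?cnorm_ge0// mulVf// repZ normrZ.
rewrite ger0_norm ?invr_ge0 ?cnorm_ge0// => /(_ (lexx _)).
by rewrite ler_pdivrMl.
Qed.

Lemma rep_bounded_by x : bounded_by (cnorm x + 1) (pi x).
Proof.
split=> [|u]; first by rewrite ltr_wpDl ?cnorm_ge0.
by rewrite (le_trans (rep_contractive _ _))// ler_wpM2r// lerDl.
Qed.

Lemma rep_cvg (x : nat -> O) l u :
  (forall e : R[i], 0 < e -> \forall n \near \oo, cnorm (x n - l) < e) ->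
  forall e, 0 < e -> exists n, `|pi l u - pi (x n) u| < e.
Proof.
move=> xl e e0; have u1 : 0 < 1 + `|u| by rewrite ltr_wpDr.
have [n _ /(_ n (leqnn _)) /= xn] := xl _ (divr_gt0 e0 u1).
exists n; rewrite -repB (le_lt_trans (rep_contractive _ _))//.
rewrite cnormBC (@le_lt_trans _ _ (cnorm (x n - l) * (1 + `|u|)))//.
  by rewrite ler_wpM2l ?cnorm_ge0// lerDr.
by rewrite -ltr_pdivlMr.
Qed.

Lemma cyclic_closed_subspace (v : H) :
  closed_subspace (closure (range (fun x : O => pi x v))).
Proof.
apply: closure_closed_subspace; first by exists 0 => //; rewrite rep0.
by move=> a _ _ [x _ <-] [y _ <-]; exists (a *: x + y) => //; rewrite rep_linear.
Qed.

Lemma cyclic_sub (v : H) (M : set H) : closed_subspace M ->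
  (forall x, M (pi x v)) -> closure (range (fun x : O => pi x v)) `<=` M.
Proof.
move=> [_ cM] Mv u uv; apply: cM; apply: closure_subset uv.
by move=> _ [x _ <-].
Qed.

Lemma cyclic_invariant (v : H) x u :
  closure (range (fun x : O => pi x v)) u ->
  closure (range (fun x : O => pi x v)) (pi x u).
Proof.
move=> uv.
have := preimage_closed_subspace (rep_bounded_by x) (cyclic_closed_subspace v).
move=> /cyclic_sub sub; apply: (sub v _ u uv) => y; apply: subset_closure.
by exists (x * y) => //; rewrite rep_mul.
Qed.

End Contractive.

Section Generation.
Context {R : realType} {N : nat} {A : 'M[bool]_N} {O : cstarAlgType R}
  {s : 'I_N -> O}.
Hypothesis Os : is_cuntz_krieger_algebra A s.

Lemma generated_subset (S : set O) :
  subalg_closed (mem S) -> (forall x, S x -> S (star x)) ->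
  (forall (u : nat -> O) (l : O), (forall n, S (u n)) ->
     (forall e : R[i], 0 < e -> \forall n \near \oo, cnorm (u n - l) < e) -> S l) ->
  (forall i, S (s i)) -> forall x, S x.
Proof. by case: Os => _ h _ *; rewrite (h S). Qed.

(** The elements x such that pi x and pi (star x) preserve M form a closed
    star-subalgebra, closed because pi is contractive. *)
Lemma invariant_of_generators {H : hilbertType R} (pi : representation O H) M :
  closed_subspace M -> (forall i u, M u -> M (pi (s i) u)) ->
  (forall i u, M u -> M (pi (star (s i)) u)) -> forall x u, M u -> M (pi x u).
Proof.
move=> cM Ms Mss x; have [M0 Ml cM'] := (closed_subspace_approxP _).1 cM.
pose S := [set x | (forall u, M u -> M (pi x u)) /\ (forall u, M u -> M (pi (star x) u))].
suff : S x by case.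
apply: generated_subset => [|y [] //|y l yS yl|i].
- split=> [|a y z|y z].
  + by rewrite in_setE; split=> u; rewrite ?star1 rep_one.
  + rewrite !in_setE => -[y1 y2] [z1 z2]; split=> u Mu.
      by rewrite rep_linear; apply: Ml; [apply: y1|apply: z1].
    by rewrite starP rep_linear; apply: Ml; [apply: y2|apply: z2].
  + rewrite !in_setE => -[y1 y2] [z1 z2]; split=> u Mu.
      by rewrite rep_mul; apply/y1/z1.
    by rewrite starM rep_mul; apply/z2/y2.
- by move=> y1 y2; split=> // u; rewrite starK; apply: y1.
- split=> u Mu; apply: cM' => e e0.
    have [n] := rep_cvg pi u yl e0.
    by exists (pi (y n) u) => //; apply: (yS n).1.
  have [|n] := rep_cvg pi u (x := fun n => star (y n)) (l := star l) _ e0.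
    by move=> d /yl; apply: filterS => n; rewrite -starB cnorm_starE.
  by exists (pi (star (y n)) u) => //; apply: (yS n).2.
- by split=> u; [apply: Ms|apply: Mss].
Qed.

(** As for invariant subspaces, the elements on which U intertwines form a
    closed star-subalgebra. *)
Lemma intertwine_generators {H H' : hilbertType R} (pi : representation O H)
  (pi' : representation O H') (U : {linear H -> H'}) :
  (forall u v, dot (U u) (U v) = dot u v) ->
  (forall i u, U (pi (s i) u) = pi' (s i) (U u)) ->
  (forall i u, U (pi (star (s i)) u) = pi' (star (s i)) (U u)) ->
  forall x u, U (pi x u) = pi' x (U u).
Proof.
move=> isoU Us Uss x.
pose S := [set x | (forall u, U (pi x u) = pi' x (U u)) /\
  (forall u, U (pi (star x) u) = pi' (star x) (U u))].
suff : S x by case.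
have lim y l : (forall n, forall u, U (pi (y n) u) = pi' (y n) (U u)) ->
    (forall e : R[i], 0 < e -> \forall n \near \oo, cnorm (y n - l) < e) ->
    forall u, U (pi l u) = pi' l (U u).
  move=> Uy yl u; apply/eqP; rewrite -subr_eq0; apply/eqP; apply: norm_small => e e0.
  have K0 : 0 < (`|u| + `|U u|) + 1 by rewrite ltr_wpDl// addr_ge0.
  have [n _ /(_ n (leqnn _)) /= yn] := yl _ (divr_gt0 e0 K0).
  have -> : U (pi l u) - pi' l (U u) = U (pi (l - y n) u) - pi' (l - y n) (U u).
    by rewrite !repB linearB Uy opprB addrA subrK.
  rewrite (le_lt_trans (ler_normB _ _))// (isometry_norm isoU).
  rewrite (le_lt_trans (lerD (rep_contractive _ _ _) (rep_contractive _ _ _)))//.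
  rewrite -mulrDr cnormBC (@le_lt_trans _ _ (cnorm (y n - l) * (`|u| + `|U u| + 1)))//.
    by rewrite ler_wpM2l ?cnorm_ge0// lerDl.
  by rewrite -ltr_pdivlMr.
apply: generated_subset => [|y [] //|y l yS yl|i].
- split=> [|a y z|y z].
  + by rewrite in_setE; split=> u; rewrite ?star1 !rep_one.
  + rewrite !in_setE => -[y1 y2] [z1 z2]; split=> u.
      by rewrite !rep_linear linearP y1 z1.
    by rewrite starP !rep_linear linearP y2 z2.
  + rewrite !in_setE => -[y1 y2] [z1 z2]; split=> u.
      by rewrite !rep_mul y1 z1.
    by rewrite starM !rep_mul z2 y2.
- by move=> y1 y2; split=> // u; rewrite starK.
- split; first by apply: lim yl => n; exact: (yS n).1.
  apply: (@lim (fun n => star (y n))); first by move=> n; exact: (yS n).2.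
  by move=> d /yl; apply: filterS => n; rewrite -starB cnorm_starE.
- by split=> u; [apply: Us|apply: Uss].
Qed.

End Generation.

(** * The Schur lemma *)

Section Schur.
Context {R : realType} {H : hilbertType R}.

(** The strong limit of the iterates; it inherits commutation from h, being a
    limit of polynomials in h. *)
Lemma contraction_fixpoint (h : {linear H -> H}) :
  (forall u, `|h u| <= `|u|) -> exists y : {linear H -> H},
  [/\ forall u, `|y u| <= `|u|,
      forall u, y u *+ 2 = h u + y (y u)
    & forall C (f : {linear H -> H}), bounded_by C f ->
        (forall u, f (h u) = h (f u)) -> forall u, f (y u) = y (f u)].
Proof.
move=> h1; pose p := picard h.
have nD (u v : H) : `|u + v| <= `|u| + `|v| by exact: ler_normD.
have nZ (a : R[i]) (u : H) : `|a *: u| = `|a| * `|u| by exact: normrZ.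
have rate m n u (nm : (n <= m)%N) := picard_cauchy nD nZ h1 u nm.
have p_contr n u : `|p n u| <= `|u|.
  rewrite (le_trans (picard_le nD nZ h1 _ _))// ler_piMl//.
  rewrite -[1](rmorph1 (real_complex R)) lecR -subr_ge0.
  by have [_ /andP[]] := @sqrt_majorant_bounds R n.
have p_cvg u : exists l, seq_lim (p ^~ u) l.
  apply: complete_seq => e e0; have e2 := divr_gt0 e0 (ltr0Sn _ 1).
  have [n0 n0P] := picard_rate_small e2 (normr_ge0 u).
  have r k : (n0 <= k)%N -> `|p k u - p n0 u| < e / 2.
    by move=> /rate r; exact: le_lt_trans (r _) (n0P _ (leqnn _)).
  exists n0 => m n /r rm /r rn; rewrite [e]splitr -[p m u](subrK (p n0 u)) -addrA.
  by rewrite (le_lt_trans (ler_normD _ _))// ltrD// distrC.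
have /choice[y0 y0P] := p_cvg.
have y0l : linear y0.
  move=> a u v; apply: seq_lim_eq (y0P _) _ => e e0.
  have [n0 n0P] := seq_limP a (y0P u) (y0P v) e0.
  by exists n0 => n /n0P; rewrite /p picardP.
pose y : {linear H -> H} := HB.pack y0 (GRing.isLinear.Build _ _ _ _ y0 y0l).
have yP u : seq_lim (p ^~ u) (y u) by exact: y0P.
have y1 u : `|y u| <= `|u| by apply: seq_lim_norm (yP u) _ => n.
exists y; split=> //.
- move=> u.
  have pp : seq_lim (fun n => p n (p n u)) (y (y u)).
    move=> e e0; have e2 := divr_gt0 e0 (ltr0Sn _ 1).
    have [n1 h1'] := yP (y u) _ e2; have [n2 h2] := yP u _ e2.
    exists (maxn n1 n2) => n; rewrite geq_max => /andP[/h1' xn /h2 yn].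
    rewrite [e]splitr -[y (y u)](subrK (p n (y u))) -addrA.
    rewrite (le_lt_trans (ler_normD _ _))// ltrD// /p -picardB.
    exact: le_lt_trans (p_contr _ _) yn.
  have cst : seq_lim (fun=> h u) (h u).
    by move=> e e0; exists 0%N => n _; rewrite subrr normr0.
  have := seq_limP 1 cst pp; rewrite scale1r => lim.
  have := seq_limP 2 (seq_lim_succ (yP u)) (_ : seq_lim (fun=> 0) 0).
  rewrite addr0 scaler_nat; move=> h2; apply: seq_lim_eq (h2 _) _.
    by move=> e e0; exists 0%N => n _; rewrite subrr normr0.
  move=> e /lim[n0 n0P]; exists n0 => n /n0P.
  by rewrite /p /= scalerA mulfV ?pnatr_eq0// !scale1r addr0.
- move=> C f fC fh u.
  have fp n v : f (p n v) = p n (f v).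
    elim: n v => [|n IH] v /=; first by rewrite linear0.
    by rewrite linearZ linearD /= fh !IH.
  apply: seq_lim_eq (yP (f u)) => e e0.
  have [n0 n0P] := seq_lim_linear fC (yP u) e0.
  by exists n0 => n /n0P; rewrite fp.
Qed.

Context {O : cstarAlgType R} (pi : representation O H).

(** The absolute value a of T is 1 - y, where y comes from h := 1 - T^2.
    Since (a - T) (a + T) = 0, irreducibility applied to the kernel of a - T
    gives T = a or T = - a.  So T is semidefinite, and <T x0, x0> = 0 forces T
    x0 = 0. *)
Lemma commutant_selfadjoint (T : {linear H -> H}) x0 :
  irreducible pi ->
  (forall u, `|T u| <= `|u|) ->
  (forall u v, dot (T u) v = dot u (T v)) ->
  (forall x u, T (pi x u) = pi x (T u)) ->
  dot (T x0) x0 = 0 -> T x0 = 0.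
Proof.
move=> [_ irr] T1 Ts Tpi Tx0.
pose h : {linear H -> H} := idfun \- (T \o T).
have hE u : h u = u - T (T u) by [].
have h1 u : `|h u| <= `|u|.
  rewrite -(@ler_pXn2r _ 2) ?nnegrE// hE -!dot_norm dnormB.
  rewrite -[dot u (T (T u))]Ts.
  have dR : (dot (T u) (T u))^* = dot (T u) (T u) by rewrite -dotC.
  have : dot (T (T u)) (T (T u)) <= dot (T u) (T u).
    by rewrite !dot_norm ler_pXn2r ?nnegrE.
  rewrite dR -subr_ge0 => d1; rewrite -subr_ge0.
  have := addr_ge0 d1 (dot_ge0 (T u)); congr (0 <= _); ring.
have [y [y1 yE yC]] := contraction_fixpoint h1.
have bT : bounded_by 1 T by split=> // u; rewrite mul1r.
have by1 : bounded_by 1 y by split=> // u; rewrite mul1r.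
have Ty u : T (y u) = y (T u).
  by apply: yC bT _ u => v; rewrite !hE linearB.
have ypi x u : y (pi x u) = pi x (y u).
  by rewrite (yC _ _ (rep_bounded_by pi x))// => v; rewrite !hE linearB !Tpi.
(* the absolute value of T *)
pose a : {linear H -> H} := idfun \- y.
have aE u : a u = u - y u by [].
have ba : bounded_by 2 a.
  split=> // u; rewrite aE (le_trans (ler_normB _ _))// mulr2n mulrDl mul1r.
  by rewrite lerD.
have aa u : a (a u) = T (T u).
  have -> : T (T u) = u + y (y u) - y u *+ 2.
    by rewrite yE hE opprD addrACA subrr addr0 opprB addrC subrK.
  by rewrite !aE linearB opprB addrACA -opprD -mulr2n.
have aT u : a (T u) = T (a u) by rewrite !aE linearB Ty.
have apos : dot (a x0) x0 = 0 -> a x0 = 0.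
  rewrite aE dotBl => /eqP; rewrite subr_eq0 => /eqP xy.
  apply/dot_eq0/le_anti; rewrite dot_ge0 andbT dnormB [dot x0 (y x0)]dotC -xy.
  have dR : (dot x0 x0)^* = dot x0 x0 by rewrite -dotC.
  rewrite !dR opprD addrACA subrr add0r subr_le0.
  by rewrite !dot_norm ler_pXn2r ?nnegrE.
(* The kernel of a - T is 0 or everything; in the first case a + T = 0, since
   a - T kills the range of a + T. *)
have [||M0|MT] := irr [set u | a u = T u].
- exact: equalizer_closed_subspace ba bT.
- move=> x u au; have {}au : a u = T u by [].
  suff : a (pi x u) = T (pi x u) by [].
  by rewrite Tpi -au !aE ypi linearB.
- have Ta u : T u = - a u.
    have : [set u | a u = T u] (a u + T u).
      suff : a (a u + T u) = T (a u + T u) by [].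
      by rewrite (linearD a) (linearD T) aa aT addrC.
    by rewrite M0 /= addrC => /eqP; rewrite addr_eq0 => /eqP.
  move: Tx0; rewrite Ta -scaleN1r dotZl mulN1r => /eqP; rewrite oppr_eq0 => /eqP.
  by move=> /apos ->; rewrite scaler0.
- have Ta u : T u = a u.
    by have : [set u | a u = T u] u by rewrite MT.
  by rewrite Ta apos// -Ta.
Qed.

(** A unitary of the commutant of an irreducible representation is scalar; in
    the form used below, it cannot move a nonzero vector to an orthogonal one.
    Its real and imaginary parts are self-adjoint contractions to which
    commutant_selfadjoint applies. *)
Lemma commutant_unitary (U : {linear H -> H}) x0 :
  irreducible pi ->
  (forall u v, dot (U u) (U v) = dot u v) ->
  (forall v, exists u, U u = v) ->
  (forall x u, U (pi x u) = pi x (U u)) ->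
  dot (U x0) x0 = 0 -> x0 = 0.
Proof.
move=> irr isoU surU Upi Ux0.
have [W [_ UW]] := unitary_inverse isoU surU.
have injU := isometry_inj isoU.
have WUd u v : dot (W u) v = dot u (U v) by rewrite -isoU UW.
have UWd u v : dot (U u) v = dot u (W v) by rewrite -{1}[v]UW isoU.
have Wn u : `|W u| = `|u| by have := isometry_norm isoU (W u); rewrite UW => <-.
have Wpi x u : W (pi x u) = pi x (W u) by apply: injU; rewrite Upi !UW.
have Wx0 : dot (W x0) x0 = 0 by rewrite WUd dotC Ux0 conjC0.
(* the real part of U and the opposite of its imaginary part *)
pose T : {linear H -> H} := 2^-1 \*: (U \+ W).
pose T' : {linear H -> H} := (2^-1 * 'i) \*: (U \- W).
have h2 : `|2^-1 : R[i]| = 2^-1 by rewrite ger0_norm// invr_ge0.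
have h2' : (2^-1 : R[i])^* = 2^-1 by rewrite conj_Creal// realE invr_ge0 ler0n.
have half u : 2^-1 * (`|U u| + `|W u|) = `|u|.
  by rewrite (isometry_norm isoU) Wn; field.
have TE u : T u = 2^-1 *: (U u + W u) by [].
have T'E u : T' u = (2^-1 * 'i) *: (U u - W u) by [].
have Tx : T x0 = 0.
  apply: commutant_selfadjoint irr _ _ _ _.
  - move=> u; rewrite TE normrZ h2 -[leRHS]half.
    by rewrite ler_wpM2l ?invr_ge0// ler_normD.
  - by move=> u v; rewrite !TE dotZl dotZr h2' dotDl dotDr UWd WUd addrC.
  - by move=> x u; rewrite !TE Upi Wpi -linearD -linearZ.
  - by rewrite TE dotZl dotDl Ux0 Wx0 addr0 mulr0.
have T'x : T' x0 = 0.
  apply: commutant_selfadjoint irr _ _ _ _.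
  - move=> u; rewrite T'E normrZ normrM h2 normCi mulr1 -[leRHS]half.
    by rewrite ler_wpM2l ?invr_ge0// ler_normB.
  - move=> u v; rewrite !T'E dotZl dotZr rmorphM /= h2' conjCi dotBl dotBr UWd WUd.
    by rewrite mulrN mulNr -mulrN opprB.
  - by move=> x u; rewrite !T'E Upi Wpi -linearB -linearZ.
  - by rewrite T'E dotZl dotBl Ux0 Wx0 subr0 mulr0.
have /eqP : U x0 = 0.
  have i0 : (2^-1 : R[i]) != 0 by rewrite invr_eq0 pnatr_eq0.
  have /eqP := Tx; rewrite TE scaler_eq0 (negPf i0) orFb addr_eq0 => /eqP UV.
  have /eqP := T'x; rewrite T'E scaler_eq0 mulf_eq0 (negPf i0) (negPf (neq0Ci _)) !orFb.
  rewrite UV -opprD oppr_eq0 -mulr2n -scaler_nat scaler_eq0 pnatr_eq0 orFb => /eqP ->.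
  by rewrite oppr0.
by rewrite -normr_eq0 (isometry_norm isoU) normr_eq0 => /eqP.
Qed.

End Schur.

(** * Cuntz-Krieger relations and chains *)

Section CuntzKriegerRep.
Context {R : realType} {N : nat} {A : 'M[bool]_N} {O : cstarAlgType R}
  {s : 'I_N -> O}.
Hypothesis Os : is_cuntz_krieger_algebra A s.

Definition word (I : seq 'I_N) : O := \prod_(j <- I) s j.

Lemma word_nil : word [::] = 1.
Proof. by rewrite /word big_nil. Qed.

Lemma word_cons i I : word (i :: I) = s i * word I.
Proof. by rewrite /word big_cons. Qed.

Lemma word_cat I J : word (I ++ J) = word I * word J.
Proof. by rewrite /word big_cat. Qed.

Lemma word_rcons I i : word (rcons I i) = word I * s i.
Proof. by rewrite -cats1 word_cat word_cons word_nil mulr1. Qed.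

Lemma star_word I : star (word I) = \prod_(j <- rev I) star (s j).
Proof.
elim: I => [|i I IH]; first by rewrite word_nil star1 big_nil.
by rewrite word_cons starM IH rev_cons -cats1 big_cat big_seq1.
Qed.

Section OneRep.
Context {H : hilbertType R} (pi : representation O H).
Implicit Types (u v : H) (i j : 'I_N) (I J : seq 'I_N).

Lemma ck_sum u : \sum_i pi (s i) (pi (star (s i)) u) = u.
Proof.
have [[_ _ h] _ _] := Os; rewrite -[RHS](rep_one pi) -h rep_sum.
by apply: eq_bigr => i _; rewrite rep_mul.
Qed.

Lemma ck_initial i u : pi (star (s i)) (pi (s i) u) =
  \sum_j (A i j)%:R *: pi (s j) (pi (star (s j)) u).
Proof.
have [[_ h _] _ _] := Os; rewrite -rep_mul h rep_sum.
by apply: eq_bigr => j _; rewrite repZ rep_mul.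
Qed.

Lemma ck_partial i u : pi (s i) (pi (star (s i)) (pi (s i) u)) = pi (s i) u.
Proof. by have [[h _ _] _ _] := Os; rewrite -!rep_mul h. Qed.

(** The range projections of the generators sum to 1. *)
Lemma ck_norm u : dot u u = \sum_i dot (pi (star (s i)) u) (pi (star (s i)) u).
Proof.
rewrite -{1}(ck_sum u) (big_morph (dot^~ u) (fun v w => dotDl v w u) (dot0l u)).
by apply: eq_bigr => i _; rewrite rep_star.
Qed.

(** By ck_norm a vector whose whole norm is seen by one adjoint is killed by
    the others. *)
Lemma ck_others i u :
  dot (pi (star (s i)) u) (pi (star (s i)) u) = dot u u ->
  forall j, j <> i -> pi (star (s j)) u = 0.
Proof.
rewrite [RHS]ck_norm (bigD1 i)//= -[LHS]addr0 => /addrI/esym/eqP.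
rewrite psumr_eq0; last by move=> *; exact: dot_ge0.
move=> /allP h j /eqP ji; apply: dot_eq0; apply/eqP.
by have := h j; rewrite mem_index_enum ji; apply.
Qed.

Lemma ck_orth i j u : i <> j -> pi (star (s i)) (pi (s j) u) = 0.
Proof.
apply: ck_others.
by rewrite rep_starl ck_partial.
Qed.

Lemma ck_SSs i u :
  dot (pi (star (s i)) u) (pi (star (s i)) u) = dot u u ->
  pi (s i) (pi (star (s i)) u) = u.
Proof.
move=> /ck_others h; rewrite -[RHS]ck_sum (bigD1 i)//= big1 ?addr0// => j /eqP ji.
by rewrite h// linear0.
Qed.

Lemma ck_SsS i u : dot (pi (s i) u) (pi (s i) u) = dot u u ->
  pi (star (s i)) (pi (s i) u) = u.
Proof.
move=> h; apply/eqP; rewrite -subr_eq0; apply/eqP/dot_eq0.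
have dR : (dot u u)^* = dot u u by rewrite -dotC.
by rewrite dnormB !rep_starl ck_partial h dR opprD addrACA subrr addr0.
Qed.

(** The vectors read off from x 0 by the adjoints along K.  Asking also that
    each step be undone by the generator makes the chains with a given word a
    linear space, stable under intertwiners; for unit vectors either relation
    implies the other. *)
Definition chain (K : nat -> 'I_N) (x : nat -> H) :=
  forall n, pi (s (K n)) (x n.+1) = x n /\ pi (star (s (K n))) (x n) = x n.+1.

Definition tail T n (K : nat -> T) : nat -> T := fun t => K (n + t)%N.

Lemma chain_shift K x n : chain K x -> chain (tail n K) (tail n x).
Proof. by move=> ch t; rewrite /tail addnS; apply: ch. Qed.

Section Chain.
Context {K : nat -> 'I_N} {x : nat -> H}.
Hypothesis ch : chain K x.

Lemma chain_word n : pi (word (mkseq K n)) (x n) = x 0%N.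
Proof.
elim: n => [|n IH]; first by rewrite word_nil rep_one.
by rewrite mkseqS word_rcons rep_mul (ch n).1.
Qed.

Lemma chain_starword n : pi (star (word (mkseq K n))) (x 0%N) = x n.
Proof.
elim: n => [|n IH]; first by rewrite word_nil star1 rep_one.
by rewrite mkseqS word_rcons starM rep_mul IH (ch n).2.
Qed.

Lemma chain_other i n : i <> K n -> pi (star (s i)) (x n) = 0.
Proof. by move=> iK; rewrite -(ch n).1 ck_orth. Qed.

(** The initial projection of s i is the sum of the range projections of the
    letters allowed after i, and the vector lies in the range of its first
    letter, which is the letter of x n when I is empty. *)
Lemma chain_next i I n : pi (star (s i)) (pi (s i) (pi (word I) (x n))) =
  (A i (head (K n) I))%:R *: pi (word I) (x n).
Proof.
have h j u : pi (star (s i)) (pi (s i) (pi (s j) u)) = (A i j)%:R *: pi (s j) u.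
  rewrite ck_initial (bigD1 j)//= big1 ?addr0 ?ck_partial// => k /eqP kj.
  by rewrite ck_orth// linear0 scaler0.
case: I => [|j I] /=; last by rewrite word_cons rep_mul h.
by rewrite word_nil rep_one -(ch n).1 h.
Qed.

(** Reading along W a vector created from x n: the letters of I are undone one
    after the other, then those of K.  Either some letter of W disagrees and
    the reading stops, or W continues like K. *)
Lemma chain_tail I n W :
  (exists t, pi (star (word (mkseq W t))) (pi (word I) (x n)) = 0) \/
  (forall t, pi (star (word (mkseq W (size I + t)))) (pi (word I) (x n)) = x (n + t)%N
     /\ W (size I + t)%N = K (n + t)%N).
Proof.
elim: I W => [|i I IH] W.
  rewrite word_nil rep_one.
  have [WK|/existsNP[t0 tK]] := pselect (forall t, W t = K (n + t)%N).
    right=> t; rewrite add0n; split=> //; have -> : mkseq W t = mkseq (tail n K) t.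
      by apply: eq_mkseq => j; exact: WK.
    have := (chain_shift n ch) => ch'.
    elim: t => [|t IH]; first by rewrite word_nil star1 rep_one addn0.
    by rewrite mkseqS word_rcons starM rep_mul IH /tail (ch _).2 addnS.
  left; have ex : exists t, W t != K (n + t)%N by exists t0; apply/eqP.
  (* reading stops at the first disagreement *)
pose t := ex_minn ex.
  exists t.+1; rewrite /t; case: ex_minnP => {t0 tK t} t /eqP tK tmin.
  rewrite mkseqS word_rcons starM rep_mul.
  suff -> : pi (star (word (mkseq W t))) (x n) = x (n + t)%N by rewrite chain_other.
  have {tmin} : forall q : nat, (q < t)%N -> W q = K (n + q)%N.
    by move=> q qt; apply: contrapT => /eqP /tmin; rewrite leqNgt qt.
  elim: t {tK} => [|t IH] h; first by rewrite word_nil star1 rep_one addn0.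
  rewrite mkseqS word_rcons starM rep_mul IH; last by move=> q qt; apply/h/ltnW.
  by rewrite (h t (ltnSn t)) (ch _).2 addnS.
have mkS V t : mkseq V t.+1 = V 0%N :: mkseq (tail 1 V) t.
  by rewrite /mkseq /= -[1%N]addn0 iotaDl -map_comp.
have red t : pi (star (word (mkseq W t.+1))) (pi (word (i :: I)) (x n)) =
    pi (star (word (mkseq (tail 1 W) t)))
      (pi (star (s (W 0%N))) (pi (s i) (pi (word I) (x n)))).
  by rewrite mkS !word_cons starM !rep_mul.
have [iW|/nesym iW] := pselect (i = W 0%N); last first.
  by left; exists 1%N; rewrite red ck_orth// linear0.
rewrite -{}iW in red.
have {}red t : pi (star (word (mkseq W t.+1))) (pi (word (i :: I)) (x n)) =
   (A i (head (K n) I))%:R *: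
    pi (star (word (mkseq (tail 1 W) t))) (pi (word I) (x n)).
  by rewrite red chain_next linearZ.
case: (A _ _) red => red; last by left; exists 1%N; rewrite red scale0r.
have [[t t0]|h] := IH (tail 1 W).
  by left; exists t.+1; rewrite red t0 scaler0.
right=> t; rewrite /= addSn red scale1r.
by have [-> <-] := h t; rewrite /tail add1n.
Qed.

Hypothesis x_cyclic : cyclic_vector pi (x 0%N).

Lemma cyclic_all M : closed_subspace M -> (forall y u, M u -> M (pi y u)) ->
  M (x 0%N) -> M = setT.
Proof.
move=> cM invM M0; apply/seteqP; split=> // u _.
have : [set: H] u by []; rewrite -x_cyclic.
by apply: cyclic_sub => // y; exact: invM.
Qed.

Definition chain_family (Im : seq 'I_N * nat) : H := pi (word Im.1) (x Im.2).

(** The span is invariant under the generators and their adjoints, by the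
    Cuntz-Krieger relations, and contains the cyclic vector x 0. *)
Lemma chain_total : closed_span (range chain_family) = setT.
Proof.
have cM := closed_spanP (range chain_family).
have gen I n : closed_span (range chain_family) (pi (word I) (x n)).
  by apply: sub_closed_span; exists (I, n).
apply: cyclic_all => //; last by have := gen [::] 0%N; rewrite word_nil rep_one.
apply: (invariant_of_generators Os) => // i u Mu.
  have := preimage_closed_subspace (rep_bounded_by pi (s i)) cM.
  move=> /closed_span_sub; apply; [|exact: Mu].
  move=> _ [[I n] _ <-]; have := gen (i :: I) n.
  by rewrite word_cons rep_mul.
have := preimage_closed_subspace (rep_bounded_by pi (star (s i))) cM.
move=> /closed_span_sub; apply; [|exact: Mu].
move=> _ [[[|j I] n] _ <-]; rewrite /preimage /chain_family /=.
  rewrite word_nil rep_one; have [->|/chain_other ->] := pselect (i = K n).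
    by rewrite (ch n).2; have := gen [::] n.+1; rewrite word_nil rep_one.
  by have /closed_subspace_approxP[] := cM.
rewrite word_cons rep_mul; have [<-|ij] := pselect (i = j).
  by rewrite chain_next; apply: closed_subspaceZ cM (gen _ _).
by rewrite ck_orth//; have /closed_subspace_approxP[] := cM.
Qed.

End Chain.

(** A chain w of the same representation has a nonzero inner product with some
    vector of the total family.  Reading both along W leaves the inner product
    unchanged, so chain_tail excludes that the reading stops. *)
Lemma tail_overlap K x W w : chain K x -> cyclic_vector pi (x 0%N) ->
  chain W w -> w 0%N <> 0 ->
  exists a b, exists2 d : R[i], d <> 0 &
    forall t, dot (w (a + t)%N) (x (b + t)%N) = d /\ W (a + t)%N = K (b + t)%N.
Proof.
move=> ch x_cyclic chw w0.
have [I [n wIn]] : exists I n, dot (pi (word I) (x n)) (w 0%N) <> 0.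
  apply: contrapT => no; apply: w0; apply: total_orthogonal (chain_total ch x_cyclic) _.
  move=> _ [[I n] _ <-]; apply: contrapT => h; apply: no; exists I, n.
  exact: h.
have E t : dot (w 0%N) (pi (word I) (x n)) =
    dot (w t) (pi (star (word (mkseq W t))) (pi (word I) (x n))).
  by rewrite -(chain_word chw t) rep_star.
have {}wIn : dot (w 0%N) (pi (word I) (x n)) <> 0.
  by rewrite dotC => /eqP; rewrite conjC_eq0 => /eqP.
have [[t t0]|h] := chain_tail ch I n W; first by case: wIn; rewrite (E t) t0 dot0r.
exists (size I), n; exists (dot (w 0%N) (pi (word I) (x n))) => // t.
by rewrite (E (size I + t)%N); have [-> ->] := h t.
Qed.

End OneRep.

(** Moving letters to the other side of the inner product compares the two
    words letter by letter; chain_next evaluates the remaining initial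
    projections in terms of A and K only. *)
Lemma gram_words {H H' : hilbertType R} (pi : representation O H)
    (pi' : representation O H') K x x' :
  chain pi K x -> chain pi' K x' ->
  (forall m n, dot (x m) (x n) = dot (x' m) (x' n)) ->
  forall I J m n, dot (pi (word I) (x m)) (pi (word J) (x n)) =
    dot (pi' (word I) (x' m)) (pi' (word J) (x' n)).
Proof.
move=> ch ch' xx I J m n.
have left J' : forall m n, dot (x m) (pi (word J') (x n)) =
    dot (x' m) (pi' (word J') (x' n)).
  elim: J' => [|j J' IH] m' n'; first by rewrite word_nil !rep_one.
  rewrite !word_cons !rep_mul -(rep_starl pi) -(rep_starl pi').
  have [->|jK] := pselect (j = K m'); first by rewrite (ch _).2 (ch' _).2.
  by rewrite (chain_other ch jK) (chain_other ch' jK) !dot0l.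
elim: I J => [|i I IH] J; first by rewrite word_nil !rep_one.
case: J => [|j J].
  by rewrite word_nil !rep_one dotC [RHS]dotC left.
rewrite !word_cons !rep_mul (rep_star pi) (rep_star pi').
have [<-|ij] := pselect (i = j); last by rewrite !ck_orth// !dot0r.
by rewrite (chain_next ch) (chain_next ch') !dotZr IH.
Qed.

(** For a unitary U, conjugation by U commutes with taking adjoints. *)
Lemma unitary_intertwiner {H H' : hilbertType R} (pi : representation O H)
    (pi' : representation O H') (U : {linear H -> H'}) :
  (forall u v, dot (U u) (U v) = dot u v) -> (forall v, exists u, U u = v) ->
  (forall i u, U (pi (s i) u) = pi' (s i) (U u)) ->
  forall x u, U (pi x u) = pi' x (U u).
Proof.
move=> isoU surU Us; apply: (intertwine_generators Os) => // i u.
apply/eqP; rewrite -subr_eq0; apply/eqP/dot_eq0.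
set v := _ - _; have [w wv] := surU v.
suff : dot v (U w) = 0 by rewrite wv.
by rewrite /v dotBl isoU !rep_starl -Us isoU subrr.
Qed.

Lemma chain_unitary {H H' : hilbertType R} (pi : representation O H)
    (pi' : representation O H') K x x' :
  chain pi K x -> chain pi' K x' ->
  cyclic_vector pi (x 0%N) -> cyclic_vector pi' (x' 0%N) ->
  (forall m n, dot (x m) (x n) = dot (x' m) (x' n)) ->
  exists U : {linear H -> H'},
    [/\ forall u v, dot (U u) (U v) = dot u v,
        forall v, exists u, U u = v,
        forall y u, U (pi y u) = pi' y (U u)
      & forall n, U (x n) = x' n].
Proof.
move=> ch ch' cy cy' xx.
have [|U [isoU surU Ux]] := unitary_of_gram _ (chain_total ch cy) (chain_total ch' cy').
  by move=> [I m] [J n]; apply: gram_words.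
exists U; split=> //.
- apply: unitary_intertwiner => // i.
  have bU := isometry_bounded isoU.
  have b1 := bounded_by_comp (rep_bounded_by pi (s i)) bU.
  have b2 := bounded_by_comp bU (rep_bounded_by pi' (s i)).
  apply: (@total_eq _ _ _ _ _ (U \o pi (s i)) (pi' (s i) \o U) _ b1 b2 (chain_total ch cy)).
  move=> _ [[I n] _ <-] /=; rewrite Ux /chain_family /=.
  by have := Ux (i :: I, n); rewrite /chain_family /= !word_cons !rep_mul.
- by move=> n; have := Ux ([::], n); rewrite /chain_family /= word_nil !rep_one.
Qed.

Lemma cyclic_shift {H : hilbertType R} (pi : representation O H) K x n :
  chain pi K x -> cyclic_vector pi (x 0%N) -> cyclic_vector pi (x n).
Proof.
move=> ch cy; apply: (cyclic_all cy); first exact: cyclic_closed_subspace.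
  by move=> y u; apply: cyclic_invariant.
by rewrite -(chain_word ch n); apply: subset_closure; exists (word (mkseq K n)).
Qed.

(** The chains starting at x m and at x n have the same word and the same Gram
    matrix, so a unitary of the commutant maps x m to x n. *)
Lemma periodic_not_irreducible {H : hilbertType R} (pi : representation O H) K x m n :
  chain pi K x -> cyclic_vector pi (x 0%N) ->
  (forall t, K (m + t)%N = K (n + t)%N) ->
  (forall t t', dot (x (m + t)%N) (x (m + t')%N) = dot (x (n + t)%N) (x (n + t')%N)) ->
  dot (x n) (x m) = 0 -> x m <> 0 -> ~ irreducible pi.
Proof.
move=> ch cy Kmn xmn xnm xm0 irr.
have KE : tail m K = tail n K by apply/funext => t; exact: Kmn.
have [|||||U [isoU surU Upi Ux]] := @chain_unitary _ _ pi pi (tail m K) (tail m x) (tail n x).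
- exact: chain_shift.
- by rewrite KE; exact: chain_shift.
- by rewrite /tail addn0; apply: cyclic_shift ch cy.
- by rewrite /tail addn0; apply: cyclic_shift ch cy.
- exact: xmn.
apply: xm0; apply: (commutant_unitary irr isoU surU Upi).
by have := Ux 0%N; rewrite /tail !addn0 => ->.
Qed.

Section Irreducible.
Context {H : hilbertType R} (pi : representation O H).

Lemma word_contractive I u :
  `|pi (word I) u| <= `|u| /\ `|pi (star (word I)) u| <= `|u|.
Proof.
have sc i v : `|pi (star (s i)) v| <= `|v|.
  rewrite -(@ler_pXn2r _ 2) ?nnegrE// -!dot_norm (ck_norm pi v) (bigD1 i)//= lerDl.
  by rewrite sumr_ge0// => j _; exact: dot_ge0.
have s_c i v : `|pi (s i) v| <= `|v|.
  have [->|v0] := eqVneq (pi (s i) v) 0; first by rewrite normr0.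
  have : `|pi (s i) v| * `|pi (s i) v| <= `|v| * `|pi (s i) v|.
    rewrite -expr2 -dot_norm -[leLHS]ger0_norm ?dot_ge0// rep_star.
    by rewrite (le_trans (CauchySchwarz_dot _ _))// ler_wpM2l.
  by rewrite ler_pM2r// normr_gt0.
split; elim: I u => [|i I IH] u; rewrite ?word_nil ?star1 ?rep_one//.
  by rewrite word_cons rep_mul (le_trans (s_c _ _)).
by rewrite word_cons starM rep_mul (le_trans (IH _)).
Qed.

(** The prefix projections are contractions, so convergence is checked on the
    total family.  There a reading that stops gives 0, and one that goes on
    leads to a chain with the word of x n, which by aperiodicity is the chain
    of x n up to a scalar. *)
Lemma prefix_limit K x n : chain pi K x -> cyclic_vector pi (x 0%N) ->
  (forall m, dot (x m) (x m) = 1) ->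
  (forall m n, (forall t, K (m + t)%N = K (n + t)%N) ->
     exists l : R[i], x m = l *: x n) ->
  forall u, seq_lim (fun t => pi (word (mkseq (tail n K) t))
    (pi (star (word (mkseq (tail n K) t))) u)) (dot u (x n) *: x n).
Proof.
move=> ch cy x1 aper u.
pose W := tail n K; have chW : chain pi W (tail n x) by exact: chain_shift.
pose E t := word (mkseq W t) * star (word (mkseq W t)).
have EE t v : pi (word (mkseq W t)) (pi (star (word (mkseq W t))) v) = pi (E t) v.
  by rewrite rep_mul.
have E1 t v : `|pi (E t) v| <= `|v|.
  by rewrite -EE (le_trans (word_contractive _ _).1)// (word_contractive _ _).2.
pose M := [set v | seq_lim (fun t => pi (E t) v) (dot v (x n) *: x n)].
suff Mu : M u by move=> e /Mu[n0 h]; exists n0 => t /h; rewrite EE.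
have xn1 : `|x n| = 1.
  by apply/eqP; rewrite -(@eqrXn2 _ 2)// -dot_norm x1 expr1n.
have cM : closed_subspace M.
  apply/closed_subspace_approxP; split.
  - by move=> e e0; exists 0%N => t _; rewrite linear0 dot0l scale0r subrr normr0.
  - move=> a v w Mv Mw e e0; have [n0 h] := seq_limP a Mv Mw e0.
    exists n0 => t /h; rewrite dotDl dotZl scalerDl -scalerA.
    by rewrite (linearP (pi (E t))).
  - move=> v h e e0; have e3 : 0 < e / 3 by rewrite divr_gt0.
    have [w Mw vw] := h _ e3; have [n0 h0] := Mw _ e3.
    exists n0 => t /h0 wt.
    have -> : dot v (x n) *: x n - pi (E t) v = dot (v - w) (x n) *: x n +
        (dot w (x n) *: x n - pi (E t) w) - pi (E t) (v - w).
      rewrite dotBl scalerBl linearB addrA subrK opprB addrA addrAC.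
      by rewrite [RHS]addrAC subrK.
    have -> : e = e / 3 + e / 3 + e / 3 by field.
    rewrite (le_lt_trans (ler_normB _ _))// ltrD//; last exact: le_lt_trans (E1 _ _) vw.
    rewrite (le_lt_trans (ler_normD _ _))// ltrD// normrZ xn1 mulr1.
    by rewrite (le_lt_trans (CauchySchwarz_dot _ _))// xn1 mulr1.
have : [set: H] u by []; rewrite -(chain_total ch cy); apply: closed_span_sub => //.
move=> _ [[I m] _ <-]; rewrite /chain_family /=; set y := pi _ _.
have yx t : dot y (x n) = dot (pi (star (word (mkseq W t))) y) (x (n + t)%N).
  rewrite rep_starl; congr (dot _ _); symmetry.
  by have := chain_word chW t; rewrite /tail addn0.
have [[t0 yt0]|h] := chain_tail ch I m W.
  rewrite /M /= (yx t0) yt0 dot0l scale0r => e e0; exists t0 => t t0t.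
  rewrite -EE -(subnKC t0t).
  have {}yt0 q' : pi (star (word (mkseq W (t0 + q')))) y = 0.
    elim: q' => [|q' IH']; first by rewrite addn0.
    by rewrite addnS mkseqS word_rcons starM rep_mul IH' linear0.
  by rewrite yt0 linear0 subrr normr0.
have [|l xm] := aper m (n + size I)%N.
  by move=> t; have [_ <-] := h t; rewrite /W /tail addnA.
have yI := (h 0%N).1; rewrite !addn0 in yI.
have lim : dot y (x n) = l by rewrite (yx (size I)) yI xm dotZl x1 mulr1.
rewrite /M /= lim => e e0; exists (size I) => t It.
have -> : pi (E t) y = l *: x n; last by rewrite subrr normr0.
rewrite -EE -(subnKC It); have [-> _] := h (t - size I)%N.
have -> : x (m + (t - size I))%N = l *: x (n + (size I + (t - size I)))%N.
  have chm := chain_shift m ch; have chn := chain_shift (n + size I) ch.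
  have KE : tail m K = tail (n + size I) K.
    by apply/funext => j; rewrite /tail; have [_ <-] := h j; rewrite /W /tail addnA.
  have := chain_starword chm (t - size I); rewrite /tail addn0 => <-.
  have := chain_starword chn (t - size I); rewrite /tail addn0 addnA => <-.
  by rewrite -/(tail m K) -/(tail (n + size I) K) KE xm linearZ.
rewrite linearZ /=; congr (_ *: _).
by have := chain_word chW (size I + (t - size I)); rewrite /tail addn0.
Qed.

(** A nonzero invariant subspace contains a vector overlapping some x n; by
    prefix_limit it contains x n, hence the cyclic vector x 0. *)
Lemma aperiodic_irreducible K x : chain pi K x -> cyclic_vector pi (x 0%N) ->
  (forall m, dot (x m) (x m) = 1) ->
  (forall m n, (forall t, K (m + t)%N = K (n + t)%N) ->
     exists l : R[i], x m = l *: x n) ->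
  irreducible pi.
Proof.
move=> ch cy x1 aper; split.
  by exists (x 0%N) => x0; have /eqP := x1 0%N; rewrite x0 dot0l eq_sym oner_eq0.
move=> M cM invM; have [|/existsNP[u uM]] := pselect (forall u, M u -> u = 0).
  move=> M0; left; apply/seteqP; split=> // _ ->.
  by have /closed_subspace_approxP[] := cM.
right; have [{}uM u0] := (not_implyP _ _).1 uM.
have [I [n uIn]] : exists I n, dot (pi (word I) (x n)) u <> 0.
  apply: contrapT => no; apply: u0; apply: total_orthogonal (chain_total ch cy) _.
  by move=> _ [[I n] _ <-]; apply: contrapT => h; apply: no; exists I, n.
pose v := pi (star (word I)) u; have Mv : M v by apply: invM.
have vn : dot v (x n) != 0.
  by rewrite rep_starl dotC conjC_eq0; apply/eqP.
have Mn : M (x n).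
  have -> : x n = (dot v (x n))^-1 *: (dot v (x n) *: x n).
    by rewrite scalerA mulVf// scale1r.
  apply: (closed_subspaceZ _ cM).
  have /closed_subspace_approxP[_ _ cM'] := cM; apply: cM' => e e0.
  have [n0 /(_ n0 (leqnn _)) h] := prefix_limit n ch cy x1 aper v e0.
  set E := word _ in h.
  by exists (pi E (pi (star E) v)); [exact/invM/invM|exact: h].
apply: (cyclic_all cy cM invM); rewrite -(chain_word ch n).
exact: invM.
Qed.

End Irreducible.

End CuntzKriegerRep.

Arguments word {R N O} s I.
Arguments chain {R N O} s {H} pi K x.

(** * Chains of the representations P(J;z) and P(k) *)

Section Stationary.
Context {R : realType} {H : hilbertType R}.

(** The Gram matrix of x depends only on differences of indices; this makes it
    insensitive to dropping first terms. *)
Definition stationary (g : nat -> R[i]) (x : nat -> H) :=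
  forall m d, dot (x (m + d)%N) (x m) = g d.

Lemma stationary_shift g x n : stationary g x -> stationary g (tail n x).
Proof. by move=> gx m d; rewrite /tail addnA gx. Qed.

(** Subtracting the projections onto the first n vectors leaves a vector of
    square norm <u, u> - n d^2, which is nonnegative. *)
Lemma bessel_constant (y : nat -> H) u (d : R[i]) :
  orthonormal_family y -> (forall n, `|dot u (y n)| = d) -> d = 0.
Proof.
move=> [y1 y0] ud.
pose r n := u - \sum_(i < n) dot u (y i) *: y i.
have rS n : r n.+1 = r n - dot u (y n) *: y n by rewrite /r big_ord_recr opprD addrA.
have ry n m : (n <= m)%N -> dot (r n) (y m) = dot u (y m).
  elim: n => [|n IH] nm; first by rewrite /r big_ord0 subr0.
  rewrite rS dotBl dotZl IH 1?ltnW// y0 ?mulr0 ?subr0//.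
  by move=> nm'; rewrite nm' ltnn in nm.
have rr n : dot (r n) (r n) = dot u u - n%:R * d ^+ 2.
  elim: n => [|n IH]; first by rewrite /r big_ord0 !subr0 mul0r subr0.
  rewrite rS dnormB dnormZ dotZr ry// y1 mulr1 IH ud.
  rewrite [_^* * _]mulrC -normCK ud rmorphXn /=.
  have -> : d^* = d by rewrite -(ud 0%N) conj_Creal// normr_real.
  by rewrite -natr1; ring.
have d0 : 0 <= d by rewrite -(ud 0%N).
apply/eqP; apply: contraT => dn0.
have u1 : 0 < dot u u + 1 by rewrite ltr_wpDl// dot_ge0.
have d2 : 0 < d ^+ 2 by rewrite exprn_gt0// lt_def dn0.
have [n /(_ n (leqnn _))] := invn_lt (divr_gt0 d2 u1).
rewrite ltr_pdivlMr// mulrC ltr_pdivrMr// mulrC => h.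
have := dot_ge0 (r n.+1); rewrite rr subr_ge0 => /(lt_le_trans h).
by rewrite gtrDl ltr10.
Qed.

(** The matrix of coefficients has orthonormal rows, so its product with its
    adjoint is the identity of size p. *)
Lemma orthonormal_span_le (p q : nat) (y : 'I_p -> H) (x : 'I_q -> H)
    (C : 'I_p -> 'I_q -> R[i]) :
  orthonormal_family y -> orthonormal_family x ->
  (forall l, y l = \sum_m C l m *: x m) -> (p <= q)%N.
Proof.
move=> [y1 y0] [x1 x0] yC.
pose M := \matrix_(l, m) C l m.
pose M' := \matrix_(m, l) (C l m)^*.
suff : M *m M' = 1%:M by apply: mulmx1_min.
apply/matrixP => l l'; rewrite !mxE.
have -> : (l == l')%:R = dot (y l) (y l').
  by have [->|/eqP/y0->] := eqVneq l l'; rewrite ?y1.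
rewrite yC (big_morph (dot^~ (y l')) (fun v w => dotDl v w (y l')) (dot0l (y l'))).
apply: eq_bigr => m _; rewrite !mxE dotZl; congr (_ * _).
rewrite yC (big_morph (dot (x m)) (fun v w => dotDr (x m) v w) (dot0r (x m))).
rewrite (bigD1 m)//= dotZr x1 mulr1 big1 ?addr0// => m' /eqP mm'.
by rewrite dotZr x0 ?mulr0//; exact: nesym.
Qed.

End Stationary.

Lemma stationary_gram {R : realType} {H H' : hilbertType R} g (x : nat -> H)
    (x' : nat -> H') :
  stationary g x -> stationary g x' ->
  forall m n, dot (x m) (x n) = dot (x' m) (x' n).
Proof.
move=> gx gx' m n; have [mn|/ltnW nm] := leqP m n; last first.
  by rewrite -(subnKC nm) gx gx'.
by rewrite dotC [RHS]dotC -(subnKC mn) gx gx'.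
Qed.

Lemma unitarily_equivalent_sym {R : realType} {O : cstarAlgType R}
    {H H' : hilbertType R} (pi : representation O H) (pi' : representation O H') :
  unitarily_equivalent pi pi' -> unitarily_equivalent pi' pi.
Proof.
move=> [U [isoU surU Upi]]; have [W [WU UW]] := unitary_inverse isoU surU.
exists W; split.
- by move=> u v; rewrite -isoU !UW.
- by move=> v; exists (U v).
- by move=> x u; apply: (isometry_inj isoU); rewrite Upi !UW.
Qed.

Section CyclicWords.
Context {N p : nat} (p0 : (0 < p)%N).

Definition cycle_word (J : p.-tuple 'I_N) (t : nat) : 'I_N :=
  tnth J (Ordinal (ltn_pmod t p0)).

Lemma cycle_word_mod J t t' : t = t' %[mod p] -> cycle_word J t = cycle_word J t'.
Proof. by move=> tt'; congr tnth; apply: val_inj. Qed.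

Lemma cycle_word_ord J (i : 'I_p) : cycle_word J i = tnth J i.
Proof. by congr tnth; apply: val_inj; rewrite /= modn_small. Qed.

Lemma ordS_pow k (i : 'I_p) :
  val ((perm (@ordS_inj p) ^+ k)%g i) = ((i + k) %% p)%N.
Proof.
elim: k => [|k IH]; first by rewrite expg0 perm1 addn0 modn_small.
by rewrite expgSr permM permE /= IH -addn1 modnDml addn1 addnS.
Qed.

Lemma cyclic_permsP (sigma : 'S_p) : sigma \in cyclic_perms p <->
  exists k, forall i, val (sigma i) = ((i + k) %% p)%N.
Proof.
split=> [/cycleP[k ->]|[k h]]; first by exists k => i; exact: ordS_pow.
apply/cycleP; exists k; apply/permP => i; apply: val_inj.
by rewrite h ordS_pow.
Qed.

Lemma cycle_word_shift (J J' : p.-tuple 'I_N) k :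
  (forall i : 'I_p, cycle_word J' (i + k) = tnth J i) ->
  forall t, cycle_word J' (t + k) = cycle_word J t.
Proof.
move=> h t; rewrite /cycle_word -h; apply: cycle_word_mod => /=.
by rewrite modnDml.
Qed.

(** The residue k of b - a, together with a time at which an index t is
    reached from a; p.-1 stands for -1 modulo p. *)
Lemma mod_diff a b : exists k, forall t, (t + k = b + (t + a * p.-1) %[mod p])%N /\
  (a + (t + a * p.-1) = t %[mod p])%N.
Proof.
exists (b + a * p.-1)%N => t; split; first by rewrite addnCA.
by rewrite addnCA -mulnS prednK// addnC modnMDl.
Qed.

End CyclicWords.

Section Chains.
Context {R : realType} {N : nat} {A : 'M[bool]_N} {O : cstarAlgType R}
  {s : 'I_N -> O}.
Hypothesis Os : is_cuntz_krieger_algebra A s.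
Context {H : hilbertType R} (pi : representation O H).

Lemma chain_of_word K x : (forall n, pi (s (K n)) (x n.+1) = x n) ->
  (forall n, dot (x n) (x n) = 1) -> chain s pi K x.
Proof.
move=> xS x1 n; split=> //; rewrite -xS (ck_SsS Os)//.
by rewrite xS !x1.
Qed.

(** The inner product of x (m + d) and x m when x (n + p) is the conjugate of
    z times x n and p successive vectors are orthonormal. *)
Definition cycle_gram p (z : R[i]) (d : nat) : R[i] :=
  if (p %| d)%N then z^* ^+ (d %/ p) else 0.

(** The vector x n is the one obtained from Omega by reading n letters of the
    periodic word: a full turn contributes the conjugate of z. *)
Lemma P_finite_chain p (p0 : (0 < p)%N) (J : p.-tuple 'I_N) z :
  `|z| = 1 -> is_P_finite s J z pi ->
  exists x, [/\ chain s pi (cycle_word p0 J) x, cyclic_vector pi (x 0%N),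
    stationary (cycle_gram p z) x & forall n, x (n + p)%N = z^* *: x n].
Proof.
move=> z1 [Om [Om1 cy SJ [v1 v0]]].
have zz : z^* * z = 1 by rewrite mulrC -normCK z1 expr1n.
pose v l := pi (word s (drop l J)) Om.
have vp : v p = Om by rewrite /v drop_oversize ?size_tuple// word_nil rep_one.
have v_0 : v 0%N = z *: Om by rewrite /v drop0 -SJ.
have vS (i : 'I_p) : v i = pi (s (tnth J i)) (v i.+1).
  by rewrite /v (drop_nth (tnth J i)) ?size_tuple// word_cons rep_mul -tnth_nth.
(* The full word maps Omega to z Omega, so a turn of the cycle from v 0 = z Omega
   to v p = Omega costs the conjugate of z. *)
pose x n := z^* ^+ (n %/ p).+1 *: v (n %% p)%N.
have xS n : x n.+1 = z^* ^+ (n %/ p).+1 *: v (n %% p).+1.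
  rewrite /x modnS divnS//; case: ifP => [pn|_]; last by rewrite add0n.
  have -> : (n %% p).+1 = p.
    have := ltn_pmod n p0; rewrite leq_eqVlt => /orP[/eqP//|np].
    move: pn; rewrite {1}(divn_eq n p) -addnS /dvdn modnMDl modn_small//.
  by rewrite vp v_0 scalerA exprSr -mulrA zz mulr1.
have x0 : x 0%N = Om.
  by rewrite /x div0n mod0n v_0 scalerA expr1 zz scale1r.
have xp n : x (n + p)%N = z^* *: x n.
  by rewrite /x modnDr divnDr ?dvdnn// divnn p0 addn1 scalerA -exprS.
have zn n : z^* ^+ n * (z^* ^+ n)^* = 1.
  by rewrite -normCK normrX norm_conjC z1 !expr1n.
have x1 n : dot (x n) (x n) = 1.
  by rewrite dotZl dotZr (v1 (Ordinal (ltn_pmod n p0))) mulr1 zn.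
exists x; split=> //.
- apply: chain_of_word => // n; rewrite xS linearZ /=; congr (_ *: _).
  by rewrite -(vS (Ordinal (ltn_pmod n p0))).
- by rewrite x0.
- move=> m d; rewrite /cycle_gram; case: ifP => [/dvdnP[q ->]|pd].
    rewrite mulnK//; suff -> : x (m + q * p)%N = z^* ^+ q *: x m.
      by rewrite dotZl x1 mulr1.
    elim: q => [|q IH]; first by rewrite mul0n addn0 scale1r.
    by rewrite mulSn addnCA addnC xp IH scalerA exprS.
  rewrite dotZl dotZr (v0 (Ordinal (ltn_pmod (m + d) p0)) (Ordinal (ltn_pmod m p0))).
    by rewrite !mulr0.
  move=> [] /eqP; rewrite -{2}[m]addn0 eqn_modDl mod0n => pd'.
  by rewrite /dvdn pd' in pd.
Qed.

(** The definition of P(k) does not put Omega = x 0 in the orthonormal family;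
    that it is orthogonal to the other x d follows from the relations, either
    because the first letters differ or because both vectors come from the
    same generator. *)
Lemma P_infinite_chain k : is_P_infinite s k pi ->
  exists x, [/\ chain s pi k x, cyclic_vector pi (x 0%N) &
    stationary (fun d => (d == 0)%:R) x].
Proof.
move=> [Om [Om1 cy [f1 f0]]].
pose x n := pi (star (word s (mkseq k n))) Om.
have xS n : x n.+1 = pi (star (s (k n))) (x n).
  by rewrite /x mkseqS word_rcons starM rep_mul.
have xf n : x n.+1 = pi (\prod_(j <- rev (mkseq k n.+1)) star (s j)) Om.
  by rewrite /x star_word.
have x0 : x 0%N = Om by rewrite /x word_nil star1 rep_one.
have x1 n : dot (x n) (x n) = 1.
  case: n => [|n]; last by rewrite xf f1.
  by rewrite x0 dot_norm Om1 expr1n.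
have ch : chain s pi k x.
  by move=> n; rewrite xS (ck_SSs Os)// -xS !x1.
exists x; split=> //; first by rewrite x0.
move=> m [|d]; first by rewrite addn0 x1 eqxx.
case: m => [|m]; last first.
  have md : (m + d.+1)%N <> m by lia.
  by rewrite addSn !xf f0.
rewrite add0n.
have [kk|kk] := pselect (k d.+1 = k 0%N).
  by rewrite -(ch d.+1).1 kk rep_star (ch 0%N).2 !xf f0.
by rewrite -(ch d.+1).1 -(ch 0%N).1 rep_star (ck_orth Os) ?dot0r//; exact: nesym.
Qed.

End Chains.

(** * Irreducibility and equivalence *)

Section Classification.
Context {R : realType} {N : nat} {A : 'M[bool]_N} {O : cstarAlgType R}
  {s : 'I_N -> O}.
Hypothesis Os : is_cuntz_krieger_algebra A s.

(** Dropping first terms changes neither cyclicity nor a stationary Gram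
    matrix. *)
Lemma stationary_equiv {H H' : hilbertType R} (pi : representation O H)
    (pi' : representation O H') K K' x x' g a b :
  chain s pi K x -> chain s pi' K' x' ->
  cyclic_vector pi (x 0%N) -> cyclic_vector pi' (x' 0%N) ->
  stationary g x -> stationary g x' -> tail a K = tail b K' ->
  unitarily_equivalent pi pi'.
Proof.
move=> ch ch' cy cy' gx gx' KK.
have [|||||U [isoU surU Upi _]] := @chain_unitary _ _ _ _ _ Os _ _ pi pi' (tail a K)
    (tail a x) (tail b x').
- exact: chain_shift.
- by rewrite KK; exact: chain_shift.
- by rewrite /tail addn0; exact: (cyclic_shift a ch cy).
- by rewrite /tail addn0; exact: (cyclic_shift b ch' cy').
- by apply: (@stationary_gram _ _ _ g); exact: stationary_shift.
by exists U.
Qed.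

Lemma unitary_chain {H H' : hilbertType R} (pi : representation O H)
    (pi' : representation O H') (U : {linear H -> H'}) K x :
  (forall y u, U (pi y u) = pi' y (U u)) -> chain s pi K x ->
  chain s pi' K (U \o x).
Proof. by move=> Upi ch n; rewrite /= -!Upi (ch n).1 (ch n).2. Qed.

Lemma equiv_overlap {H H' : hilbertType R} (pi : representation O H)
    (pi' : representation O H') K K' x x' :
  chain s pi K x -> chain s pi' K' x' -> cyclic_vector pi' (x' 0%N) ->
  dot (x 0%N) (x 0%N) = 1 -> unitarily_equivalent pi pi' ->
  exists (U : {linear H -> H'}) a b, exists2 d : R[i], d <> 0 &
    forall t, dot (U (x (a + t)%N)) (x' (b + t)%N) = d /\ K (a + t)%N = K' (b + t)%N.
Proof.
move=> ch ch' cy' x1 [U [isoU surU Upi]].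
have [|a [b h]] := tail_overlap Os ch' cy' (unitary_chain Upi ch).
  move=> /= U0; have /eqP := x1.
  by rewrite -isoU U0 dot0l eq_sym oner_eq0.
by exists U, a, b.
Qed.

Lemma cycle_gram0 p z : cycle_gram p z 0 = 1 :> R[i].
Proof. by rewrite /cycle_gram dvdn0 div0n expr0. Qed.

Section Finite.
Context {p : nat} {z : R[i]} (z1 : `|z| = 1).
Context {H : hilbertType R} {x : nat -> H}.
Hypothesis x_period : forall n, x (n + p)%N = z^* *: x n.

Lemma period_mul n q : x (n + q * p)%N = z^* ^+ q *: x n.
Proof.
elim: q => [|q IH]; first by rewrite mul0n addn0 scale1r.
by rewrite mulSn addnCA addnC x_period IH scalerA exprS.
Qed.

Lemma period_phase m n : m = n %[mod p] ->
  exists2 l : R[i], l != 0 & x m = l *: x n.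
Proof.
have z0 : z^* != 0 by rewrite conjC_eq0 -normr_eq0 z1 oner_eq0.
move=> mn; exists (z^* ^+ (m %/ p) / z^* ^+ (n %/ p)).
  by rewrite mulf_neq0 ?invr_eq0 ?expf_neq0.
have E r : x r = z^* ^+ (r %/ p) *: x (r %% p)%N.
  by rewrite {1}(divn_eq r p) [X in x X]addnC period_mul.
by rewrite (E m) (E n) mn scalerA divfK// expf_neq0.
Qed.

End Finite.

Lemma cycle_orthonormal {H : hilbertType R} p z (x : nat -> H) :
  stationary (cycle_gram p z) x -> orthonormal_family (fun m : 'I_p => x m).
Proof.
move=> gx; have lt (i j : 'I_p) : (i < j)%N -> dot (x j) (x i) = 0.
  move=> ij; rewrite -(subnKC (ltnW ij)) gx /cycle_gram; case: ifP => // /dvdn_leq.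
  by rewrite subn_gt0 => /(_ ij); have := ltn_ord j; lia.
split=> [m|m m' mm']; first by rewrite -[X in dot (x X)]addn0 gx cycle_gram0.
have [/lt h|/lt //|/val_inj //] := ltngtP m m'.
by rewrite dotC h conjC0.
Qed.

(** By periodic_not_irreducible and aperiodic_irreducible, irreducibility
    means that the periods of the word are those of the chain.  A nontrivial
    rotation fixing J is a period of the repeated word smaller than the period
    p of the chain, and conversely. *)
Lemma P_finite_irreducible {H : hilbertType R} (pi : representation O H) p
    (p0 : (0 < p)%N) (J : p.-tuple 'I_N) z :
  `|z| = 1 -> is_P_finite s J z pi ->
  irreducible pi <->
  ~ exists sigma : 'S_p, [/\ sigma \in cyclic_perms p, sigma <> 1%g
      & [tuple tnth J (sigma i) | i < p] = J].
Proof.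
move=> z1 /(P_finite_chain Os p0 z1)[x [ch cy gx xp]].
have x1 n : dot (x n) (x n) = 1.
  by rewrite -[X in dot (x X)]addn0 gx cycle_gram0.
split=> [irr [sigma [/cyclic_permsP[k sk] s1 sJ]]|no].
  have Kk : forall t, cycle_word p0 J (t + k) = cycle_word p0 J t.
    apply: cycle_word_shift => i; rewrite -[in RHS]sJ tnth_mktuple.
    by rewrite /cycle_word; congr tnth; apply: val_inj; rewrite /= sk.
  apply: (periodic_not_irreducible Os ch cy (m := 0%N) (n := k)) irr.
  - by move=> t; rewrite add0n addnC Kk.
  - by apply: (@stationary_gram _ _ _ (cycle_gram p z)); exact: stationary_shift.
  - rewrite -[k]add0n gx /cycle_gram; case: ifP => // pk; case: s1.
    apply/permP => i; apply: val_inj; rewrite sk perm1.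
    by rewrite -modnDmr (eqP pk) addn0 modn_small.
  - by move=> x00; have /eqP := x1 0%N; rewrite x00 dot0l eq_sym oner_eq0.
apply: (aperiodic_irreducible Os ch cy x1).
(* If the words read from n and from n + d agree, rotating by d fixes J. *)
have K_period m n d : m = (n + d)%N -> (forall t, cycle_word p0 J (m + t) =
    cycle_word p0 J (n + t)) -> m = n %[mod p].
  move=> -> h; apply: contrapT => nd; apply: no.
  exists (perm (@ordS_inj p) ^+ d)%g; split.
  - exact: mem_cycle.
  - move=> /permP/(_ (Ordinal (ltn_pmod n p0)))/(congr1 val).
    by rewrite ordS_pow perm1 /= modnDml.
  - apply/eq_from_tnth => i; rewrite tnth_mktuple.
    rewrite -!cycle_word_ord -[RHS](@cycle_word_mod _ _ p0 J (n + (i + n * p.-1))); last first.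
      by rewrite addnCA -mulnS prednK// addnC modnMDl.
    rewrite -h; apply: cycle_word_mod; rewrite ordS_pow modn_mod.
    have -> : (n + d + (i + n * p.-1) = n * p + (i + d))%N.
      have -> : (n * p = n + n * p.-1)%N by rewrite -mulnS prednK.
      lia.
    by rewrite modnMDl.
move=> m n h; suff mn : m = n %[mod p].
  by have [l _ ->] := period_phase z1 xp mn; exists l.
have [mn|/ltnW nm] := leqP m n.
  by apply/esym/(K_period _ _ (n - m)%N); rewrite ?subnKC.
by apply/(K_period _ _ (m - n)%N); rewrite ?subnKC.
Qed.

Lemma P_infinite_irreducible {H : hilbertType R} (pi : representation O H) k :
  is_P_infinite s k pi ->
  irreducible pi <->
  ~ exists q n0 : nat, (1 <= q)%N /\ forall n, (n0 <= n)%N -> k (n + q)%N = k n.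
Proof.
move=> /(P_infinite_chain Os)[x [ch cy gx]].
have x1 n : dot (x n) (x n) = 1 by rewrite -[X in dot (x X)]addn0 gx.
split=> [irr [q [n0 [q1 kq]]]|no].
  apply: (periodic_not_irreducible Os ch cy (m := n0) (n := (n0 + q)%N)) irr.
  - by move=> t; rewrite addnAC kq// leq_addr.
  - by apply: (@stationary_gram _ _ _ (fun d => (d == 0%N)%:R)); exact: stationary_shift.
  - by rewrite gx; case: q q1 {kq}.
  - by move=> x00; have /eqP := x1 n0; rewrite x00 dot0l eq_sym oner_eq0.
apply: (aperiodic_irreducible Os ch cy x1) => m n h.
have [->|/eqP mn] := eqVneq m n; first by exists 1; rewrite scale1r.
exfalso; apply: no; have [lt_mn|lt_nm|//] := ltngtP m n.
  exists (n - m)%N, m; split; first by rewrite subn_gt0.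
  move=> t mt; have := h (t - m)%N; rewrite subnKC// => ->; congr k; lia.
exists (m - n)%N, n; split; first by rewrite subn_gt0.
move=> t nt; have := h (t - n)%N; rewrite [in RHS]subnKC// => <-; congr k; lia.
Qed.

(** An overlap of the two chains would be constant in modulus along multiples
    of p, while one chain is orthonormal and the other one is constant up to
    phases. *)
Lemma finite_infinite_inequivalent {H H' : hilbertType R} (pi : representation O H)
    (pi' : representation O H') p (p0 : (0 < p)%N) (J : p.-tuple 'I_N) z k :
  `|z| = 1 -> is_P_finite s J z pi -> is_P_infinite s k pi' ->
  ~ unitarily_equivalent pi pi'.
Proof.
move=> z1 /(P_finite_chain Os p0 z1)[x [ch cy gx xp]].
move=> /(P_infinite_chain Os)[x' [ch' cy' gx']] eqv.
have x1 : dot (x 0%N) (x 0%N) = 1.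
  by rewrite -[X in dot (x X)]addn0 gx cycle_gram0.
have [U [a [b [d d0 h]]]] := equiv_overlap ch ch' cy' x1 eqv.
apply: d0; apply/eqP; rewrite -normr_eq0; apply/eqP.
apply: (@bessel_constant _ _ (fun j => x' (b + j * p)%N) (U (x a))).
  split=> [i|i j ij].
    by rewrite -[X in dot (x' X)]addn0 gx'.
  have [lt_ij|lt_ji|//] := ltngtP i j.
    rewrite dotC (_ : b + j * p = (b + i * p) + (j - i) * p)%N ?gx'; last by nia.
    by rewrite muln_eq0 subn_eq0 leqNgt lt_ij eqn0Ngt p0 conjC0.
  rewrite (_ : b + i * p = (b + j * p) + (i - j) * p)%N ?gx'; last by nia.
  by rewrite muln_eq0 subn_eq0 leqNgt lt_ji eqn0Ngt p0.
move=> j; have [<- _] := h (j * p)%N.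
rewrite (period_mul xp) linearZ /= dotZl normrM normrX norm_conjC z1.
by rewrite expr1n mul1r.
Qed.

(** A chain w with periodic word W starts in the span of the cycle.  Subtract
    from w the chains x (m + -) that have word W, with the coefficients that
    make w 0 orthogonal to their first vectors; the difference is again a
    chain with word W, and if it were nonzero it would overlap one of these
    chains at a common multiple of the periods. *)
Lemma chain_span {H : hilbertType R} (pi : representation O H) p (p0 : (0 < p)%N)
    (J : p.-tuple 'I_N) z (x : nat -> H) W w q :
  `|z| = 1 -> chain s pi (cycle_word p0 J) x -> cyclic_vector pi (x 0%N) ->
  stationary (cycle_gram p z) x -> (forall n, x (n + p)%N = z^* *: x n) ->
  chain s pi W w -> (0 < q)%N -> (forall t, W (t + q)%N = W t) ->
  exists C : 'I_p -> R[i], w 0%N = \sum_m C m *: x m.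
Proof.
move=> z1 ch cy gx xp chw q0 Wq; set K := cycle_word p0 J in ch.
have [x1 x_orth] := cycle_orthonormal gx.
pose match_ (m : 'I_p) := `[< tail m K = W >].
pose C m := if match_ m then dot (w 0%N) (x m) else 0.
pose w' t := w t - \sum_m C m *: x (m + t)%N.
exists C; apply/eqP; rewrite -subr_eq0.
have -> : w 0%N - \sum_m C m *: x m = w' 0%N.
  by rewrite /w'; congr (_ - _); apply: eq_bigr => m _; rewrite addn0.
have chw' : chain s pi W w'.
  move=> n; rewrite /w' (linearB (pi (s (W n)))) (linear_sum (pi (s (W n)))).
  rewrite (linearB (pi (star (s (W n))))) (linear_sum (pi (star (s (W n))))).
  rewrite (chw n).1 (chw n).2; split; congr (_ - _); apply: eq_bigr => m _.
    rewrite linearZ /= /C; case: ifP => [/asboolP <-|_]; last by rewrite !scale0r.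
    by rewrite /tail addnS (ch _).1.
  rewrite linearZ /= /C; case: ifP => [/asboolP <-|_]; last by rewrite !scale0r.
  by rewrite /tail addnS (ch _).2.
have w'x m : match_ m -> dot (w' 0%N) (x m) = 0.
  move=> mm; rewrite /w' dotBl.
  rewrite (big_morph (dot^~ (x m)) (fun v w => dotDl v w (x m)) (dot0l (x m))).
  rewrite (bigD1 m)//= big1 ?addr0 => [|m' /eqP m'm]; last first.
    by rewrite addn0 dotZl x_orth ?mulr0.
  by rewrite addn0 dotZl x1 mulr1 /C mm subrr.
apply: contraT => /eqP w'0; exfalso.
have [a [b [d d0 h]]] := tail_overlap Os ch cy chw' w'0.
have WqM t n : W (n * q + t)%N = W t.
  elim: n => [|n IH]; first by rewrite mul0n add0n.
  by rewrite mulSn -addnA addnC Wq.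
(* The overlap is moved to a time Q that is a multiple of both periods, where
   the chain of x has come back to a vector of the cycle. *)
pose Q := (a * (p * q))%N; have aQ : (a <= Q)%N by rewrite leq_pmulr// muln_gt0 p0.
pose b' := (b + (Q - a))%N; pose m := Ordinal (ltn_pmod b' p0).
have WK t : W t = K (m + t)%N.
  have := (h (Q - a + t)%N).2; rewrite !addnA (subnKC aQ) -/b'.
  rewrite /Q mulnA WqM => ->; apply: cycle_word_mod.
  by rewrite /= modnDml.
have mm : match_ m by apply/asboolP/funext => t; rewrite WK.
have [|l l0 xb] := period_phase z1 xp (m := b') (n := (m + Q)%N).
  by rewrite /= modnDml /Q mulnCA [(p * _)%N]mulnC addnC modnMDl.
apply: d0; rewrite -(h (Q - a)%N).1 (subnKC aQ) -/b' xb dotZr.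
rewrite -(chain_starword chw' Q) rep_starl.
have -> : W = tail m K by apply/funext.
have := chain_word (chain_shift m ch) Q; rewrite {2 3}/tail addn0 => ->.
by rewrite w'x// mulr0.
Qed.

(** The p orthonormal vectors of one cycle are carried into the span of the p'
    vectors of the other one. *)
Lemma finite_equiv_le {H H' : hilbertType R} (pi : representation O H)
    (pi' : representation O H') p p' (p0 : (0 < p)%N) (p'0 : (0 < p')%N)
    (J : p.-tuple 'I_N) (J' : p'.-tuple 'I_N) z z' :
  `|z| = 1 -> `|z'| = 1 -> is_P_finite s J z pi -> is_P_finite s J' z' pi' ->
  unitarily_equivalent pi pi' -> (p <= p')%N.
Proof.
move=> z1 z'1 /(P_finite_chain Os p0 z1)[x [ch cy gx xp]].
move=> /(P_finite_chain Os p'0 z'1)[x' [ch' cy' gx' xp']] [U [isoU surU Upi]].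
have span (l : 'I_p) : exists C : 'I_p' -> R[i], U (x l) = \sum_m C m *: x' m.
  have chw := chain_shift l (unitary_chain Upi ch).
  have [|C CE] := chain_span z'1 ch' cy' gx' xp' chw p0.
    move=> t; rewrite /tail addnA; apply: cycle_word_mod; exact: modnDr.
  by exists C; rewrite -CE /tail /= addn0.
have [C CE] := choice span.
have [x1 x0] := cycle_orthonormal gx.
apply: orthonormal_span_le _ (cycle_orthonormal gx') CE.
by split=> [l|l l' /x0]; rewrite isoU.
Qed.

Lemma cast_tnth_cycle p p' (p0 : (0 < p)%N) (p'0 : (0 < p')%N) (e : p = p')
    (J : p'.-tuple 'I_N) (i : 'I_p) :
  tnth J (cast_ord e i) = cycle_word p'0 J i.
Proof. by rewrite -cycle_word_ord. Qed.

(** The phases agree because the constant overlap is multiplied by z^* * z'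
    after one turn. *)
Lemma P_finite_equiv {H H' : hilbertType R} (pi : representation O H)
    (pi' : representation O H') p p' (p0 : (0 < p)%N) (p'0 : (0 < p')%N)
    (J : p.-tuple 'I_N) (J' : p'.-tuple 'I_N) z z' :
  `|z| = 1 -> `|z'| = 1 -> is_P_finite s J z pi -> is_P_finite s J' z' pi' ->
  unitarily_equivalent pi pi' <->
  exists epp' : p = p', z = z' /\
    exists2 sigma : 'S_p, sigma \in cyclic_perms p &
      forall n, tnth J' (cast_ord epp' (sigma n)) = tnth J n.
Proof.
move=> z1 z'1 PJ PJ'; split=> [eqv|].
  have epp' : p = p'.
    apply/eqP; rewrite eqn_leq; apply/andP; split.
      exact: (finite_equiv_le p0 p'0 z1 z'1 PJ PJ' eqv).
    exact: (finite_equiv_le p'0 p0 z'1 z1 PJ' PJ (unitarily_equivalent_sym eqv)).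
  exists epp'.
  have [x [ch cy gx xp]] := P_finite_chain Os p0 z1 PJ.
  have [x' [ch' cy' gx' xp']] := P_finite_chain Os p'0 z'1 PJ'.
  have x1 : dot (x 0%N) (x 0%N) = 1.
    by rewrite -[X in dot (x X)]addn0 gx cycle_gram0.
  have [U [a [b [d d0 h]]]] := equiv_overlap ch ch' cy' x1 eqv.
  split.
    have UZ : U (z^* *: x a) = z^* *: U (x a) by rewrite linearZ.
    have := (h p).1; rewrite xp UZ epp' xp' dotZl dotZr conjCK.
    have := (h 0%N).1; rewrite !addn0 => ->; rewrite mulrA -{2}[d]mul1r.
    move/(mulIf (introN eqP d0)) => zz'.
    have : z * (z^* * z') = z by rewrite zz' mulr1.
    by rewrite mulrA -normCK z1 expr1n mul1r.
  have [k hk] := mod_diff p0 a b.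
  exists (perm (@ordS_inj p) ^+ k)%g; first exact: mem_cycle.
  move=> i; rewrite (cast_tnth_cycle p0 p'0) -cycle_word_ord; have [h1 h2] := hk i.
  rewrite -(@cycle_word_mod _ _ p0 J _ _ h2) (h _).2; apply: cycle_word_mod.
  by rewrite ordS_pow -epp' modn_mod.
case=> epp'; case: _ / epp' J' p'0 PJ' => J' p'0 PJ' [zz' [sigma /cyclic_permsP[k sk] sJ]].
rewrite -zz' in PJ'.
have [x [ch cy gx xp]] := P_finite_chain Os p0 z1 PJ.
have [x' [ch' cy' gx' xp']] := P_finite_chain Os p0 z1 PJ'.
apply: (stationary_equiv (a := 0%N) (b := k) ch ch' cy cy' gx gx').
apply/funext => t; rewrite /tail add0n addnC; apply/esym/cycle_word_shift => i.
rewrite -sJ cast_ord_id /cycle_word; congr tnth; apply: val_inj.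
by rewrite /= sk.
Qed.

(** Equality of tails is the conclusion of tail_overlap and the hypothesis of
    stationary_equiv. *)
Lemma P_infinite_equiv {H H' : hilbertType R} (pi : representation O H)
    (pi' : representation O H') k k' :
  is_P_infinite s k pi -> is_P_infinite s k' pi' ->
  unitarily_equivalent pi pi' <->
  exists (q : int) (n0 : nat), forall n, (n0 <= n)%N ->
    exists m : nat, m%:Z = n%:Z + q /\ k m = k' n.
Proof.
move=> /(P_infinite_chain Os)[x [ch cy gx]].
move=> /(P_infinite_chain Os)[x' [ch' cy' gx']].
have x1 n : dot (x n) (x n) = 1 by rewrite -[X in dot (x X)]addn0 gx.
split=> [eqv|[q [n0 h]]].
  have [U [a [b [d d0 h]]]] := equiv_overlap ch ch' cy' (x1 _) eqv.
  exists (a%:Z - b%:Z), b => n bn; exists (a + (n - b))%N; split; first lia.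
  by rewrite (h _).2 subnKC.
have [m0 [m0E _]] := h _ (leqnn n0).
apply: (stationary_equiv (a := m0) (b := n0) ch ch' cy cy' gx gx').
apply/funext => t; rewrite /tail; have [|m [mE <-]] := h (n0 + t)%N.
  exact: leq_addr.
congr k; lia.
Qed.

End Classification.

(** * Permutative bases and their orbits *)

Section SubRepresentation.
Context {R : realType} {O : cstarAlgType R} {H : hilbertType R}.
Variables (pi : representation O H) (M : set H) (cM : closed_subspace M).
Hypothesis invM : forall x u, M u -> M (pi x u).
Local Notation W := (sub_hilbert cM).

Lemma sub_rep_subproof x (u : W) : pi x (\val u) \in mem M.
Proof. by rewrite in_setE; apply: invM; have := valP u; rewrite in_setE. Qed.

Definition sub_rep_fun x (u : W) : W := SubHilbert cM (sub_rep_subproof x u).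

Lemma sub_rep_linear x : linear (sub_rep_fun x).
Proof.
by move=> a u v; apply: val_inj; rewrite /= !(linearP, raddfD, linearZ).
Qed.

HB.instance Definition _ x :=
  GRing.isLinear.Build R[i] W W *:%R (sub_rep_fun x) (sub_rep_linear x).

Lemma sub_rep_continuous x : continuous (sub_rep_fun x).
Proof.
have [C0 fC] := rep_bounded_by pi x.
apply: (@bounded_by_continuous _ W W (cnorm x + 1) (sub_rep_fun x)); split=> // u.
by rewrite !sub_hilbert_norm; apply: fC.
Qed.

Definition sub_rep : representation O W.
Proof.
apply: (@Representation _ _ _ (fun x => sub_rep_fun x : {linear W -> W})).
- exact: sub_rep_continuous.
- by move=> a x y u; apply: val_inj; rewrite /= rep_linear.
- by move=> u; apply: val_inj; rewrite /= rep_one.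
- by move=> x y u; apply: val_inj; rewrite /= rep_mul.
- by move=> x u v; rewrite !sub_hilbert_dot /= rep_star.
Defined.

Lemma sub_repE x (u : W) : \val (sub_rep x u) = pi x (\val u).
Proof. by []. Qed.

End SubRepresentation.

Section Permutative.
Context {R : realType} {N : nat} {A : 'M[bool]_N} {O : cstarAlgType R}
  {s : 'I_N -> O}.
Hypothesis Os : is_cuntz_krieger_algebra A s.

(** The domains and the maps of the definition can be recovered by choice from
    this form. *)
Lemma permutative_basisP {H : hilbertType R} (pi : representation O H) L (e : L -> H) :
  permutative_basis s pi e <-> orthonormal_basis e /\
    forall i n, pi (s i) (e n) = 0 \/
      exists z m, `|z| = 1 /\ pi (s i) (e n) = z *: e m.
Proof.
split=> [[be [D [z [m zm]]]]|[be h]]; split=> //.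
  move=> i n; have [zm1 zm2] := zm i n.
  by have [/zm1[z1 E]|/zm2] := pselect (D i n); [right; exists (z i n), (m i n)|left].
have /choice[f fP] (x : 'I_N * L) : exists zm : R[i] * L,
    pi (s x.1) (e x.2) <> 0 -> `|zm.1| = 1 /\ pi (s x.1) (e x.2) = zm.1 *: e zm.2.
  have [h0|[z [m zm]]] := h x.1 x.2; first by exists (1, x.2).
  by exists (z, m).
exists (fun i n => pi (s i) (e n) <> 0), (fun i n => (f (i, n)).1), (fun i n => (f (i, n)).2).
move=> i n; split; first exact: (fP (i, n)).
by move=> /contrapT.
Qed.

Section Basis.
Context {H : hilbertType R} (pi : representation O H) {L : Type} (e : L -> H).
Hypothesis e_perm : permutative_basis s pi e.

Lemma basis_norm n : dot (e n) (e n) = 1.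
Proof. by case: e_perm => [[[]]]. Qed.

Lemma basis_orth m n : m <> n -> dot (e m) (e n) = 0.
Proof. by case: e_perm => [[[_ h] _] _]; apply: h. Qed.

Lemma basis_total : closed_span (range e) = setT.
Proof. by case: e_perm => [[]]. Qed.

Lemma basis_neq0 n : e n <> 0.
Proof. by move=> en; have /eqP := basis_norm n; rewrite en dot0l eq_sym oner_eq0. Qed.

Lemma basis_eq a m n : a *: e m = e n -> m = n.
Proof.
move=> E; apply: contrapT => /basis_orth h; apply: (@basis_neq0 n).
by apply: dot_eq0; rewrite -{1}E dotZl h mulr0.
Qed.

Lemma unit_neq0 (z : R[i]) : `|z| = 1 -> z != 0.
Proof. by move=> z1; rewrite -normr_eq0 z1 oner_eq0. Qed.

(** A generator is isometric on the basis vectors that it does not kill, so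
    its adjoint undoes it there. *)
Lemma basis_adjoint i m z n : `|z| = 1 -> pi (s i) (e m) = z *: e n ->
  pi (star (s i)) (e n) = z^-1 *: e m.
Proof.
move=> z1 E; have z0 := unit_neq0 z1.
have := ck_SsS Os (pi := pi) (i := i) (u := e m).
rewrite E dotZl dotZr !basis_norm mulr1 -normCK z1 expr1n linearZ /= => /(_ erefl) <-.
by rewrite scalerA mulVf// scale1r.
Qed.

(** The adjoints cannot all kill e n, because the range projections sum to 1;
    so e n is, up to a phase, the image of some basis vector e (F n) under one
    generator, and it is orthogonal to the ranges of the others. *)
Lemma permutative_structure : exists (lt : L -> 'I_N) (F : L -> L) (w : L -> R[i]),
  [/\ forall n, `|w n| = 1,
      forall n, pi (star (s (lt n))) (e n) = w n *: e (F n),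
      forall n, pi (s (lt n)) (e (F n)) = (w n)^-1 *: e n,
      forall j n, j <> lt n -> pi (star (s j)) (e n) = 0 &
      forall i m, pi (s i) (e m) = 0 \/
        exists z n, [/\ `|z| = 1, pi (s i) (e m) = z *: e n & F n = m]].
Proof.
have [_ se] := (permutative_basisP _ _).1 e_perm.
have ex n : exists x : 'I_N * L * R[i], `|x.2| = 1 /\ pi (s x.1.1) (e x.1.2) = x.2 *: e n.
  apply: contrapT => no; apply: (@basis_neq0 n); rewrite -(ck_sum Os pi (e n)).
  apply: big1 => i _.
  suff -> : pi (star (s i)) (e n) = 0 by rewrite linear0.
  apply: total_orthogonal basis_total _ => _ [m _ <-].
  rewrite -rep_star; have [->|[z [n' [z1 E]]]] := se i m; first by rewrite dot0l.
  rewrite E dotZl basis_orth ?mulr0// => nn'; apply: no.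
  by exists (i, m, z); rewrite /= E nn'.
have [f fP] := choice ex.
pose lt n := (f n).1.1; pose F n := (f n).1.2; pose w n := (f n).2^-1.
have w1 n : `|w n| = 1 by rewrite normfV (fP n).1 invr1.
have Sse n : pi (star (s (lt n))) (e n) = w n *: e (F n).
  exact: basis_adjoint (fP n).1 (fP n).2.
have others j n : j <> lt n -> pi (star (s j)) (e n) = 0.
  apply: (ck_others Os).
  by rewrite Sse dotZl dotZr !basis_norm mulr1 -normCK w1 expr1n.
exists lt, F, w; split=> //.
  by move=> n; rewrite (fP n).2 invrK.
move=> i m; have [->|[z [n [z1 E]]]] := se i m; [by left|right; exists z, n; split=> //].
have Ssn := basis_adjoint z1 E.
have [il|/others h] := pselect (i = lt n); last first.
  have /eqP := Ssn; rewrite h eq_sym scaler_eq0 invr_eq0 (negPf (unit_neq0 z1)).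
  by move/eqP/basis_neq0.
apply: (@basis_eq (z * w n)); rewrite -scalerA -Sse -il Ssn scalerA mulfV ?unit_neq0//.
by rewrite scale1r.
Qed.

Context {lt : L -> 'I_N} {F : L -> L} {w : L -> R[i]}.
Hypothesis w1 : forall n, `|w n| = 1.
Hypothesis Sse : forall n, pi (star (s (lt n))) (e n) = w n *: e (F n).
Hypothesis Se : forall n, pi (s (lt n)) (e (F n)) = (w n)^-1 *: e n.
Hypothesis Sse0 : forall j n, j <> lt n -> pi (star (s j)) (e n) = 0.
Hypothesis Se_inv : forall i m, pi (s i) (e m) = 0 \/
        exists z n, [/\ `|z| = 1, pi (s i) (e m) = z *: e n & F n = m].

Definition path_word n a := mkseq (fun t => lt (iter t F n)) a.

Lemma path_star n a : exists2 z : R[i], `|z| = 1 &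
  pi (star (word s (path_word n a))) (e n) = z *: e (iter a F n).
Proof.
elim: a => [|a [z z1 E]].
  by exists 1; rewrite ?normr1// word_nil star1 rep_one scale1r.
exists (z * w (iter a F n)); first by rewrite normrM z1 w1 mulr1.
by rewrite /path_word mkseqS word_rcons starM rep_mul E linearZ /= Sse scalerA.
Qed.

Lemma path_creation n a : exists2 z : R[i], `|z| = 1 &
  pi (word s (path_word n a)) (e (iter a F n)) = z *: e n.
Proof.
elim: a => [|a [z z1 E]].
  by exists 1; rewrite ?normr1// word_nil rep_one scale1r.
exists ((w (iter a F n))^-1 * z); first by rewrite normrM normfV z1 w1 invr1 mulr1.
by rewrite /path_word mkseqS word_rcons rep_mul Se linearZ /= E scalerA.
Qed.

Definition same_orbit m n := exists a b, iter a F m = iter b F n.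

Lemma same_orbit_refl n : same_orbit n n.
Proof. by exists 0%N, 0%N. Qed.

Lemma same_orbit_sym m n : same_orbit m n -> same_orbit n m.
Proof. by move=> [a [b h]]; exists b, a. Qed.

Lemma same_orbit_trans m n q : same_orbit m n -> same_orbit n q -> same_orbit m q.
Proof.
move=> [a [b h]] [c [d h']]; exists (c + a)%N, (b + d)%N.
by rewrite iterD h -iterD addnC iterD h' -iterD.
Qed.

(** Read along the orbit of m down to the common vector, then create along the
    orbit of n. *)
Lemma same_orbit_rep m n : same_orbit m n -> exists x : O, pi x (e m) = e n.
Proof.
move=> [a [b h]]; have [z z1 E] := path_star m a; have [y y1 E'] := path_creation n b.
exists ((z * y)^-1 *: (word s (path_word n b) * star (word s (path_word m a)))).
rewrite repZ rep_mul E linearZ /= h E' !scalerA.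
by rewrite -mulrA mulVf ?scale1r// mulf_neq0 ?unit_neq0.
Qed.

Definition orbit_space n := closed_span (e @` same_orbit n).

(** Generators and their adjoints move a basis vector by one step of F,
    backwards or forwards. *)
Lemma orbit_space_invariant n x u : orbit_space n u -> orbit_space n (pi x u).
Proof.
have cM := closed_spanP (e @` same_orbit n); have [M0 _ _] := (closed_subspace_approxP _).1 cM.
have gen m : same_orbit n m -> orbit_space n (e m).
  by move=> nm; apply: sub_closed_span; exists m.
apply: (invariant_of_generators Os cM) => {x} {}i {}u Mu.
  have := preimage_closed_subspace (rep_bounded_by pi (s i)) cM.
  move=> /closed_span_sub; apply; [|exact: Mu] => _ [m nm <-] /=.
  have [->//|[z [q [z1 -> Fq]]]] := Se_inv i m.
  apply: (closed_subspaceZ _ cM); apply: gen; apply: same_orbit_trans nm _.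
  by exists 0%N, 1%N; rewrite /= Fq.
have := preimage_closed_subspace (rep_bounded_by pi (star (s i))) cM.
move=> /closed_span_sub; apply; [|exact: Mu] => _ [m nm <-] /=.
have [->|/Sse0->//] := pselect (i = lt m).
rewrite Sse; apply: (closed_subspaceZ _ cM); apply: gen; apply: same_orbit_trans nm _.
by exists 1%N, 0%N.
Qed.

Lemma orbit_orthogonal n m x : ~ same_orbit n m -> dot (pi x (e n)) (e m) = 0.
Proof.
move=> nm.
have Mx : orbit_space n (pi x (e n)).
  apply: orbit_space_invariant; apply: sub_closed_span; exists n => //.
  exact: same_orbit_refl.
apply: (closed_span_sub (orthogonal_closed_subspace (e m)) _ Mx) => _ [q nq <-].
by apply: basis_orth => qm; apply: nm; rewrite -qm.
Qed.

Lemma orbit_cyclic n m : same_orbit n m -> cyclic_vector pi (e n) ->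
  cyclic_vector pi (e m).
Proof.
move=> /same_orbit_sym/same_orbit_rep[y yE] cy; apply/seteqP; split=> // u _.
have : [set: H] u by []; rewrite -cy.
apply: cyclic_sub (cyclic_closed_subspace pi (e m)) _ _ => x.
by apply: subset_closure; exists (x * y) => //; rewrite rep_mul yE.
Qed.

(** If the orbit of n meets itself, the vector m where it does lies on a
    cycle, whose minimal length p makes the vectors of the cycle distinct, and
    the letters read along the cycle form J.  Otherwise the letters read along
    the whole orbit form k. *)
Lemma cyclic_permutative n : cyclic_vector pi (e n) ->
  (exists (p : nat) (J : p.-tuple 'I_N) (z : R[i]),
     [/\ (1 <= p)%N, `|z| = 1 & is_P_finite s J z pi]) \/
  (exists k : nat -> 'I_N, is_P_infinite s k pi).
Proof.
move=> cy.
have norm1 m : `|e m| = 1.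
  by apply/eqP; rewrite -(@eqrXn2 _ 2)// -dot_norm basis_norm expr1n.
have dotzz (y z : R[i]) m : `|y| = 1 -> `|z| = 1 -> y = z ->
    dot (y *: e m) (z *: e m) = 1.
  by move=> y1 z1 yz; rewrite dotZl dotZr basis_norm mulr1 yz -normCK z1 expr1n.
have [[a [q [q0 Fq]]]|inj] := pselect (exists a q, (0 < q)%N /\
    iter (a + q) F n = iter a F n); [left|right].
  pose m := iter a F n.
  have cym : cyclic_vector pi (e m).
    by apply: orbit_cyclic cy; exists a, 0%N.
  have ex : exists q, (0 < q)%N && `[< iter q F m = m >].
    by exists q; rewrite q0; apply/asboolP; rewrite /m -iterD addnC.
  case: (ex_minnP ex) => p /andP[p0 /asboolP Fp] pmin.
  (* A coincidence on the cycle would give a period shorter than p. *)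
have distinct i j : (i < j)%N -> (j < p)%N -> iter i F m <> iter j F m.
    move=> ij jp E.
    have : (p <= i + (p - j))%N; last by lia.
    apply: pmin; apply/andP; split; first lia.
    apply/asboolP; rewrite addnC iterD E -iterD subnK// ltnW//.
  pose J := [tuple lt (iter i F m) | i < p].
  have JE l : (l <= p)%N -> drop l J = path_word (iter l F m) (p - l).
    move=> lp; apply: (@eq_from_nth _ (lt m)).
      by rewrite size_drop size_tuple size_mkseq.
    move=> i; rewrite size_drop size_tuple => il.
    rewrite nth_drop nth_mkseq// -iterD [in RHS]addnC.
    have ip : (l + i < p)%N by lia.
    by rewrite -[X in nth _ _ X]/(val (Ordinal ip)) -tnth_nth tnth_mktuple.
  have vE l : (l <= p)%N -> exists2 z : R[i], `|z| = 1 &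
      pi (word s (drop l J)) (e m) = z *: e (iter l F m).
    move=> lp; have [z z1] := path_creation (iter l F m) (p - l).
    by rewrite -iterD subnK// Fp => E; exists z => //; rewrite JE.
  have [z z1 zE] := vE 0%N (leq0n _); rewrite drop0 in zE.
  exists p, J, z; split=> //; exists (e m); split=> //.
  split=> [l|l l' ll'].
    have [y y1 E] := vE l (ltnW (ltn_ord l)).
    by rewrite -/(word s _) E; apply: dotzz.
  have [y y1 E] := vE l (ltnW (ltn_ord l)).
  have [y' y'1 E'] := vE l' (ltnW (ltn_ord l')).
  rewrite -!/(word s _) E E' dotZl dotZr basis_orth ?mulr0//.
  have [/distinct h|/distinct h|/val_inj//] := ltngtP l l'.
    exact: h.
  by apply/nesym/h.
pose k t := lt (iter t F n); exists k, (e n); split=> //.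
have vE t : exists2 z : R[i], `|z| = 1 &
    pi (\prod_(j <- rev (mkseq k t)) star (s j)) (e n) = z *: e (iter t F n).
  by rewrite -star_word; exact: path_star.
split=> [t|t t' tt'].
  by have [z z1 ->] := vE t.+1; apply: dotzz.
have [z z1 ->] := vE t.+1; have [z' z'1 ->] := vE t'.+1.
have distinct i j : (i < j)%N -> iter i.+1 F n <> iter j.+1 F n.
  move=> ij E; apply: inj; exists i.+1, (j - i)%N; rewrite subn_gt0; split=> //.
  by have -> : (i.+1 + (j - i) = j.+1)%N by lia.
rewrite dotZl dotZr basis_orth ?mulr0//.
have [/distinct h|/distinct h|//] := ltngtP t t'; first exact: h.
by apply/nesym/h.
Qed.

End Basis.

Arguments same_orbit {L} F m n.

Lemma permutative_cyclic {H : hilbertType R} (pi : representation O H) L (e : L -> H) n :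
  permutative_basis s pi e -> cyclic_vector pi (e n) ->
  (exists (p : nat) (J : p.-tuple 'I_N) (z : R[i]),
     [/\ (1 <= p)%N, `|z| = 1 & is_P_finite s J z pi]) \/
  (exists k : nat -> 'I_N, is_P_infinite s k pi).
Proof.
move=> e_perm; have [lt [F [w [w1 Sse Se Sse0 Se_inv]]]] := permutative_structure e_perm.
exact: (cyclic_permutative e_perm w1 Sse Se).
Qed.

(** The summands are the closed spans of the classes of basis vectors with
    meeting orbits. *)
Lemma permutative_decomposition {H : hilbertType R} (pi : representation O H) L
    (e : L -> H) :
  permutative_basis s pi e ->
  exists (K : Type) (Hk : K -> hilbertType R)
    (pik : forall k, representation O (Hk k)), cyclic_decomposition s pi e pik.
Proof.
move=> e_perm; have [lt [F [w [w1 Sse Se Sse0 Se_inv]]]] := permutative_structure e_perm.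
pose K := {C : set L | exists n, C = same_orbit F n}.
pose M (k : K) := closed_span (e @` sval k).
have cM k : closed_subspace (M k) by exact: closed_spanP.
have invM k x u : M k u -> M k (pi x u).
  rewrite /M; case: k => C /= [n ->].
  exact: (orbit_space_invariant Sse Sse0 Se_inv).
pose Hk k : hilbertType R := sub_hilbert (cM k).
pose pik k : representation O (Hk k) := sub_rep (cM k) (@invM k).
exists K, Hk, pik.
pose V k : {linear Hk k -> H} := @sub_incl _ _ _ (cM k).
exists V; split.
  split.
  - by [].
  - move=> k l u v kl.
    have Mu : M k (V k u) by have := valP u; rewrite in_setE.
    have Mv : M l (V l v) by have := valP v; rewrite in_setE.
    apply: closed_span_orthogonal Mu Mv => _ _ [m km <-] [m' lm' <-].
    apply: (basis_orth e_perm) => mm'; apply: kl; rewrite -{m'}mm' in lm'.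
    case: k l {u v} km lm' => [C hC] [D hD] /= Cm Dm.
    apply: eq_exist; case: hC Cm => n ->; case: hD Dm => n' -> n'm nm.
    apply/seteqP; split=> q h.
      apply: same_orbit_trans n'm _; apply: same_orbit_trans (same_orbit_sym nm) h.
    by apply: same_orbit_trans nm _; apply: same_orbit_trans (same_orbit_sym n'm) h.
  - apply/seteqP; split=> // u _.
    have : [set: H] u by []; rewrite -(basis_total e_perm).
    apply: closed_span_sub; first exact: closed_spanP.
    move=> _ [n _ <-]; apply: sub_closed_span.
    have kP : exists n', same_orbit F n = same_orbit F n' by exists n.
    pose k : K := exist _ _ kP; exists k => //.
    have Mn : e n \in mem (M k).
      rewrite in_setE; apply: sub_closed_span; exists n => //.
      exact: same_orbit_refl.
    by exists (SubHilbert (cM k) Mn).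
  - by [].
move=> k.
have Me (n : {n : L | sval k n}) : e (sval n) \in mem (M k).
  by rewrite in_setE; apply: sub_closed_span; exists (sval n) => //; exact: (svalP n).
pose ek n : Hk k := SubHilbert (cM k) (Me n).
exists {n : L | sval k n}, ek; split; last by move=> n; exists (sval n).
have ek_total : closed_span (range ek) = setT.
  apply/seteqP; split=> // u _.
  have isoV : forall u v, dot (V k u) (V k v) = dot u v by [].
  have cN := isometry_image_closed isoV (closed_spanP (range ek)).
  have Mu : M k (V k u) by have := valP u; rewrite in_setE.
  have [|v Nv uv] := closed_span_sub cN _ Mu.
    move=> _ [n Cn <-]; exists (ek (exist _ n Cn)) => //.
    by apply: sub_closed_span; exists (exist _ n Cn).
  by rewrite -(isometry_inj isoV uv).
have [n0 Ck] : exists n0, sval k = same_orbit F n0 by case: k {ek ek_total Me}.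
split.
  apply/permutative_basisP; split.
    split=> //; split=> [n|n n' nn']; rewrite sub_hilbert_dot /=.
      exact: (basis_norm e_perm).
    by apply: (basis_orth e_perm) => h; apply: nn'; case: n n' h => [n hn] [n' hn'] /= h;
      apply: eq_exist.
  move=> i [n Cn]; have [h0|[z [m [z1 E Fm]]]] := Se_inv i n.
    by left; apply: val_inj.
  have Cm : sval k m.
    rewrite Ck in Cn *; apply: same_orbit_trans Cn _.
    by exists 0%N, 1%N.
  right; exists z, (exist _ m Cm); split=> //.
  by apply: val_inj; rewrite sub_repE.
have Cn0 : sval k n0 by rewrite Ck; exact: same_orbit_refl.
exists (exist _ n0 Cn0); apply/seteqP; split=> // u _.
have : [set: Hk k] u by []; rewrite -ek_total.
apply: closed_span_sub; first exact: cyclic_closed_subspace.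
move=> _ [[n Cn] _ <-]; apply: subset_closure.
have [|x xn] := same_orbit_rep w1 Sse Se (m := n0) (n := n); first by rewrite -Ck.
by exists x => //; apply: val_inj; rewrite sub_repE.
Qed.

(** The basis vectors in a summand of any decomposition along e form exactly
    one class, since a basis vector outside the class of the cyclic one is
    orthogonal to the whole summand.  Summands over the same class have the
    same orthonormal basis, up to the embeddings. *)
Lemma decomposition_unique {H : hilbertType R} (pi : representation O H) L
    (e : L -> H) :
  permutative_basis s pi e ->
  forall (K K' : Type) (Hk : K -> hilbertType R) (Hk' : K' -> hilbertType R)
    (pik : forall k, representation O (Hk k))
    (pik' : forall k, representation O (Hk' k)),
  cyclic_decomposition s pi e pik -> cyclic_decomposition s pi e pik' ->
  exists phi : K -> K', bijective phi /\
    forall k, unitarily_equivalent (pik k) (pik' (phi k)).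
Proof.
move=> e_perm; have [lt [F [w [w1 Sse Se Sse0 Se_inv]]]] := permutative_structure e_perm.
(* In each summand of a decomposition, the basis vectors form one class,
   represented by b, and are total. *)
have orbit_of (K : Type) (Hk : K -> hilbertType R) (pik : forall k, representation O (Hk k))
    (V : forall k, {linear Hk k -> H}) :
    is_direct_sum pi pik V ->
    (forall k, exists (Lk : Type) (ek : Lk -> Hk k),
      cyclic_permutative_basis s (pik k) ek /\ forall n, range e (V k (ek n))) ->
    exists b : K -> L, [/\
      forall k m, same_orbit F (b k) m -> exists u, V k u = e m,
      forall k m u, V k u = e m -> same_orbit F (b k) m,
      forall k k', same_orbit F (b k) (b k') -> k = k',
      forall m, exists k, same_orbit F (b k) m &
      forall k, closed_span [set u | exists m, V k u = e m] = setT].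
  move=> [isoV orthV totV Vpi] basisV.
  have /choice[b bP] k : exists b, (forall m, same_orbit F b m -> exists u, V k u = e m) /\
      (forall m u, V k u = e m -> same_orbit F b m).
    have [Lk [ek [[ekP [n cyn]] ekV]]] := basisV k.
    have [b _ bE] := ekV n; exists b; split.
      move=> m /(same_orbit_rep w1 Sse Se)[x <-].
      by exists (pik k x (ek n)); rewrite Vpi bE.
    move=> m u um; apply: contrapT => bm; apply: (basis_neq0 e_perm (n := m)).
    rewrite -um; suff -> : u = 0 by rewrite linear0.
    apply: dot_eq0.
    have : [set: Hk k] u by []; rewrite -cyn.
    apply: cyclic_sub (orthogonal_closed_subspace u) _ _ => x.
    rewrite /= -(isoV k) Vpi um -bE.
    exact: (orbit_orthogonal e_perm Sse Sse0 Se_inv).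
  exists b; split.
  - by move=> k; exact: (bP k).1.
  - by move=> k; exact: (bP k).2.
  - move=> k k' kk'; apply: contrapT => nkk'.
    have [u uE] := (bP k).1 _ kk'; have [u' u'E] := (bP k').1 _ (same_orbit_refl (b k')).
    have /eqP := basis_norm e_perm (b k'); rewrite -{1}uE -u'E orthV//.
    by rewrite eq_sym oner_eq0.
  - move=> m; apply: contrapT => no; apply: (basis_neq0 e_perm (n := m)).
    apply: total_orthogonal totV _ => _ [k _ [u _ <-]].
    have [Lk [ek [[ekP [n cyn]] ekV]]] := basisV k.
    have [c _ cE] := ekV n.
    have bc : same_orbit F (b k) c by apply: (bP k).2 (esym cE).
    have cm : ~ same_orbit F c m.
      by move=> cm; apply: no; exists k; exact: same_orbit_trans bc cm.
    have cN := preimage_closed_subspace (isometry_bounded (isoV k))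
      (orthogonal_closed_subspace (e m)).
    have : [set: Hk k] u by []; rewrite -cyn.
    apply: (cyclic_sub cN) => x /=.
    by rewrite Vpi -cE; exact: (orbit_orthogonal e_perm Sse Sse0 Se_inv).
  - move=> k; have [Lk [ek [[[[_ ekT] _] _] ekV]]] := basisV k.
    apply/seteqP; split=> // u _; have : [set: Hk k] u by []; rewrite -ekT.
    apply: closed_span_sub; first exact: closed_spanP.
    move=> _ [n _ <-]; apply: sub_closed_span.
    by have [m _ mE] := ekV n; exists m.
move=> K K' Hk Hk' pik pik' [V [sumV basisV]] [V' [sumV' basisV']].
have [b [b1 b2 b3 b4 b5]] := orbit_of _ _ _ _ sumV basisV.
have [b' [b'1 b'2 b'3 b'4 b'5]] := orbit_of _ _ _ _ sumV' basisV'.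
have [isoV _ _ Vpi] := sumV; have [isoV' _ _ V'pi] := sumV'.
have /choice[phi phiP] k := b'4 (b k).
have /choice[psi psiP] k' := b4 (b' k').
exists phi; split.
  exists psi => [k|k'].
    apply: b3; apply: same_orbit_trans (psiP _) (phiP k).
  apply: b'3; apply: same_orbit_trans (phiP _) (psiP k').
move=> k; set k' := phi k.
pose I := {m : L | same_orbit F (b k) m}.
have /choice[f fE] (i : I) : exists u, V k u = e (sval i) by exact: b1 (svalP i).
have /choice[f' f'E] (i : I) : exists u, V' k' u = e (sval i).
  by apply: b'1; apply: same_orbit_trans (phiP k) (svalP i).
have fT : closed_span (range f) = setT.
  rewrite -(b5 k); congr closed_span; apply/seteqP; split=> [_ [i _ <-]|u [m um]].
    by exists (sval i); exact: fE.
  exists (exist _ m (b2 _ _ _ um)) => //.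
  by apply: (isometry_inj (isoV k)); rewrite um fE.
have f'T : closed_span (range f') = setT.
  rewrite -(b'5 k'); congr closed_span; apply/seteqP; split=> [_ [i _ <-]|u [m um]].
    by exists (sval i); exact: f'E.
  have bm : same_orbit F (b k) m.
    by apply: same_orbit_trans (same_orbit_sym (phiP k)) (b'2 _ _ _ um).
  by exists (exist _ m bm) => //; apply: (isometry_inj (isoV' k')); rewrite um f'E.
have [|U [isoU surU Uf]] := unitary_of_gram _ fT f'T.
  by move=> i j; rewrite -(isoV k) -(isoV' k') !fE !f'E.
have VU u : V' k' (U u) = V k u.
  have bV := isometry_bounded (isoV k); have bV' := isometry_bounded (isoV' k').
  have bU := bounded_by_comp (isometry_bounded isoU) bV'.
  apply: (@total_eq _ _ _ _ _ (V' k' \o U) (V k) _ bU bV fT) => _ [i _ <-] /=.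
  by rewrite Uf f'E fE.
exists U; split=> // x u.
by apply: (isometry_inj (isoV' k')); rewrite VU Vpi V'pi VU.
Qed.

End Permutative.
(** * Classification of permutative representations with phases *)

Theorem theorem1p2 (R : realType) (N : nat) (A : 'M[bool]_N)
    (O : cstarAlgType R) (s : 'I_N -> O) :
  (2 <= N)%N -> nondegenerate_mx A -> is_cuntz_krieger_algebra A s ->
  (* (i), (ii) *)
  (forall (H : hilbertType R) (pi : representation O H) (L : Type) (e : L -> H),
     permutative_basis s pi e ->
     [/\ exists (K : Type) (Hk : K -> hilbertType R)
           (pik : forall k, representation O (Hk k)),
           cyclic_decomposition s pi e pik,
         forall (K K' : Type)
           (Hk : K -> hilbertType R) (Hk' : K' -> hilbertType R)
           (pik : forall k, representation O (Hk k))
           (pik' : forall k, representation O (Hk' k)),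
           cyclic_decomposition s pi e pik ->
           cyclic_decomposition s pi e pik' ->
           exists phi : K -> K', bijective phi /\
             forall k, unitarily_equivalent (pik k) (pik' (phi k))
       & (exists n, cyclic_vector pi (e n)) ->
           (exists (p : nat) (J : p.-tuple 'I_N) (z : R[i]),
              [/\ (1 <= p)%N, `|z| = 1 & is_P_finite s J z pi]) \/
           (exists k : nat -> 'I_N, is_P_infinite s k pi)]) /\
  forall (p p' : nat) (J : p.-tuple 'I_N) (J' : p'.-tuple 'I_N) (c c' : R[i])
    (k k' : nat -> 'I_N),
    (1 <= p)%N -> (1 <= p')%N ->
    admissible_cycle A J -> admissible_cycle A J' ->
    `|c| = 1 -> `|c'| = 1 ->
    admissible_word A k -> admissible_word A k' ->
    [/\ (* (iii) *)
        (forall (H : hilbertType R) (pi : representation O H),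
           is_P_finite s J c pi ->
           irreducible pi <->
           ~ exists sigma : 'S_p,
               [/\ sigma \in cyclic_perms p, sigma <> 1%g
                 & [tuple tnth J (sigma i) | i < p] = J]) /\
        (forall (H : hilbertType R) (pi : representation O H),
           is_P_infinite s k pi ->
           irreducible pi <->
           ~ exists q n0 : nat, (1 <= q)%N /\
               forall n, (n0 <= n)%N -> k (n + q)%N = k n),
        (* (iv) *)
        forall (H H' : hilbertType R)
          (pi : representation O H) (pi' : representation O H'),
          is_P_finite s J c pi -> is_P_infinite s k pi' ->
          ~ unitarily_equivalent pi pi',
        (* (v) *)
        forall (H H' : hilbertType R)
          (pi : representation O H) (pi' : representation O H'),
          is_P_finite s J c pi -> is_P_finite s J' c' pi' ->
          unitarily_equivalent pi pi' <->
          exists epp' : p = p', c = c' /\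
            exists2 sigma : 'S_p, sigma \in cyclic_perms p &
              forall n, tnth J' (cast_ord epp' (sigma n)) = tnth J n
      & (* (vi) *)
        forall (H H' : hilbertType R)
          (pi : representation O H) (pi' : representation O H'),
          is_P_infinite s k pi -> is_P_infinite s k' pi' ->
          unitarily_equivalent pi pi' <->
          exists (q : int) (n0 : nat), forall n, (n0 <= n)%N ->
            exists m : nat, m%:Z = n%:Z + q /\ k m = k' n].
Proof.
move=> _ _ Os; split.
  move=> H pi L e e_perm; split.
  - exact: (permutative_decomposition Os e_perm).
  - exact: (decomposition_unique Os e_perm).
  - by move=> [n cy]; exact: (permutative_cyclic Os e_perm cy).
move=> p p' J J' c c' k k' p0 p'0 _ _ c1 c'1 _ _; split.
- split=> H pi; first exact: (P_finite_irreducible Os p0 c1).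
  exact: (P_infinite_irreducible Os).
- by move=> H H' pi pi' PJ Pk; exact: (finite_infinite_inequivalent Os p0 c1 PJ Pk).
- by move=> H H' pi pi' PJ PJ'; exact: (P_finite_equiv Os p0 p'0 c1 c'1 PJ PJ').
- by move=> H H' pi pi' Pk Pk'; exact: (P_infinite_equiv Os Pk Pk').
Qed.
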